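(* For every $C>0$ there is a constant $c=c(C)>0$ such that every $N$-vertex $C$-Ramsey graph $G$ satisfies $f(G)\ge c\,N^{2/3}$.
   Context: Graphs are finite and simple. For a graph $G$, a set $U\subset V(G)$ is homogeneous if the induced subgraph $G[U]$ is complete or empty (has no edges). An $N$-vertex graph $G$ is called $C$-Ramsey if it has no homogeneous set of size at least $C\log N$. For a graph $G$, $f(G)$ denotes the largest $k\in\mathbb{N}$ such that $G$ has an induced subgraph $H$ with $k$ distinct degrees, i.e. such that the set $\{d_H(v):v\in V(H)\}$ has at least $k$ elements. *)

(* Defs.v *)
(* A finite simple graph is a symmetric,
   irreflexive relation [e] on a [T : finType]; the induced subgraph on
   [U : {set T}] is represented by [U] itself. *)
From mathcomp Require Import all_boot all_order all_algebra.
From mathcomp Require Import reals exp.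

Set Implicit Arguments.
Unset Strict Implicit.
Unset Printing Implicit Defensive.

Import Order.TTheory GRing.Theory Num.Theory.
Local Open Scope ring_scope.

Definition simple_graph (T : finType) (e : rel T) : Prop :=
  symmetric e /\ irreflexive e.

Definition complete_on (T : finType) (e : rel T) (U : {set T}) : bool :=
  [forall u in U, forall v in U, (u != v) ==> e u v].

Definition empty_on (T : finType) (e : rel T) (U : {set T}) : bool :=
  [forall u in U, forall v in U, ~~ e u v].

Definition homogeneous (T : finType) (e : rel T) (U : {set T}) : bool :=
  complete_on e U || empty_on e U.

(* [ln] is the natural logarithm; changing its base only rescales [C].  Since
   [ln 0 = ln 1 = 0] and [set0] is homogeneous, no graph on at most one vertex
   is [C]-Ramsey. *)
Definition ramsey (R : realType) (C : R) (T : finType) (e : rel T) : Prop :=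
  ~ exists U : {set T}, homogeneous e U /\ C * ln #|T|%:R <= #|U|%:R.

Definition degree_in (T : finType) (e : rel T) (U : {set T}) (v : T) : nat :=
  #|[set w in U | e v w]|.

Definition num_degrees (T : finType) (e : rel T) (U : {set T}) : nat :=
  size (undup [seq degree_in e U v | v in U]).

Definition max_distinct_degrees (T : finType) (e : rel T) : nat :=
  \max_(U : {set T}) num_degrees e U.

(* Main.v *)
Require Import Defs.
From mathcomp Require Import all_boot all_order all_algebra.
From mathcomp Require Import zify ring lra.
From mathcomp Require Import reals exp.

Set Implicit Arguments.
Unset Strict Implicit.
Unset Printing Implicit Defensive.

Import Order.TTheory GRing.Theory Num.Theory.
Local Open Scope ring_scope.

(** Write N for the number of vertices and N(v) for the neighbourhood of v.
    Choose t with 64^t <= N < 64^(t+1) and put r = 2^t, so that r^6 is N up to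
    a constant and the goal is an induced subgraph with a constant times r^4
    distinct degrees.  The proof has two independent halves.

    Separation.  A Ramsey graph contains a set U of r^4 vertices any two of
    which have neighbourhoods that differ in a constant fraction of all
    vertices ([separated_of_ramsey]).  Otherwise the vertices are covered by
    fewer than r^4 clusters whose members have almost the same neighbourhood.
    One then builds a homogeneous set greedily, in a constant number K of
    rounds ([greedy_step]).  A round finds, inside one cluster, many vertices
    that nearly agree with all earlier picks, thins them out until the
    agreement with most of these picks is exact ([prune]), and
    extracts a clique or an independent set of size a constant times log N
    whose type matches the majority behaviour of the cluster centre on the
    vertices still available; both types are available because an off-diagonal
    Ramsey bound holds with polynomial loss ([off_diagonal]).  Since K is large
    the picks of one type form a homogeneous set that is too big.

    Spreading the degrees.  Keep all of U and choose the other vertices at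
    random so that u and v have the same degree with probability O(r^(-4)) for
    all but O(r^4) pairs u, v in U.  Then the expected number of colliding pairs in U is O(r^4), and
    by Cauchy-Schwarz ([card_sqr_collisions]) some outcome has a constant times
    r^4 distinct degrees already on U.  The degrees of u and v would collide
    with probability about 1 / sqrt N = r^(-3) if the vertices were chosen by fair
    coins; the missing factor 1/r comes from a bias.  Each a in U draws a
    random tilt z_a from r equally spaced values, and a vertex w is chosen with
    probability 1/2 plus a small multiple of the sum of the z_a over the
    neighbours a of w in U.  Chebyshev's inequality shows that for most z only
    few of these probabilities leave [0,1] and have to be clipped.  For such z,
    moving z_u through its r values shifts the expected difference of the degrees
    of u and v monotonically, in steps of order sqrt N ([mean_update]), so only
    O(1) of the r values put this expectation near the point of collision.
    The contributions of the distant values are summed with a point bound that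
    decays quadratically with the distance to the mean ([point_le_quadratic]).
    That bound needs two blocks of fair coins, so the biased choice is made
    only on one part D of the complement of U, and fair coins are used on two
    further parts; a random splitting ([halving]) ensures that
    almost all pairs of U are still well separated on each part. *)

(** * Ramsey arguments with weights *)

Definition mono (T : finType) (e : rel T) (b : bool) (Q : {set T}) : Prop :=
  {in Q &, forall x y, x != y -> e x y = b}.

Lemma mono_homogeneous (T : finType) (e : rel T) b (Q : {set T}) :
  irreflexive e -> mono e b Q -> homogeneous e Q.
Proof.
move=> irr mQ; rewrite /homogeneous; case: b mQ => mQ; apply/orP; [left|right].
  apply/'forall_implyP => x xQ; apply/'forall_implyP => y yQ.
  by apply/implyP => /(mQ x y xQ yQ).
apply/'forall_implyP => x xQ; apply/'forall_implyP => y yQ.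
by have [->|/(mQ x y xQ yQ)->] := eqVneq x y; rewrite ?irr.
Qed.

Lemma mono0 (T : finType) (e : rel T) b : mono e b set0.
Proof. by move=> x y; rewrite inE. Qed.

Lemma monoU1 (T : finType) (e : rel T) b v (Q : {set T}) :
  symmetric e -> mono e b Q -> {in Q, forall w, e v w = b} -> mono e b (v |: Q).
Proof.
move=> sym mQ vQ x y /setU1P[->|xQ] /setU1P[->|yQ] //; rewrite ?eqxx // => nxy.
- exact: vQ.
- by rewrite sym; apply: vQ.
- exact: mQ.
Qed.

(** An Erdos-Szekeres bound in product form: up to rounding,
    (L+1)^k ((L+1)/L)^l vertices suffice.  A vertex has either a fraction
    1/(L+1) of the others as [b]-neighbours or a fraction L/(L+1) of them as
    non-[b]-neighbours, and the two losses are charged to [k] and to [l].  With L large a set of a small power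
    of N vertices already contains cliques and independent sets of size a small
    constant times log N. *)
Lemma off_diagonal (T : finType) (e : rel T) (b : bool) (L k l : nat) (B : {set T}) :
  symmetric e -> (0 < L)%N ->
  ((L.+1) ^ (k + l) < #|B|.+1 * L ^ l)%N ->
  (exists Q : {set T}, [/\ Q \subset B, mono e b Q & #|Q| = k]) \/
  (exists Q : {set T}, [/\ Q \subset B, mono e (~~ b) Q & #|Q| = l]).
Proof.
move=> sym L0; move: {2}(k + l)%N (leqnn (k + l)) => n.
elim: n k l B => [|n IH] [|k] [|l] B //= le_n hB;
  try (by left; exists set0; rewrite sub0set cards0; split=> //; exact: mono0);
  try (by right; exists set0; rewrite sub0set cards0; split=> //; exact: mono0).
have B0 : (0 < #|B|)%N.
  rewrite lt0n; apply: contraTneq hB => ->; rewrite -leqNgt mul1n.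
  apply: (@leq_trans (L.+1 ^ l.+1)); first by rewrite leq_exp2r.
  by rewrite leq_exp2l //; lia.
have /card_gt0P[v vB] := B0.
pose B1 := [set w in B :\ v | e v w == b].
pose B2 := [set w in B :\ v | e v w != b].
have cB : #|B| = (#|B1| + #|B2|).+1.
  rewrite (cardsD1 v) vB add1n; congr _.+1.
  rewrite -(cardsID [set w | e v w == b] (B :\ v)).
  by congr addn; apply: eq_card => w; rewrite !inE // [RHS]andbC.
have add_v c (Q : {set T}) : mono e c Q -> Q \subset [set w in B :\ v | e v w == c] ->
    [/\ v |: Q \subset B, mono e c (v |: Q) & #|v |: Q| = #|Q|.+1].
  move=> mQ /subsetP sQ; split.
  - by apply/subsetP => w /setU1P[->//|/sQ]; rewrite !inE => /andP[/andP[]].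
  - by apply: monoU1 => // w /sQ; rewrite !inE => /andP[_ /eqP].
  - rewrite cardsU1; case: (boolP (v \in Q)) => // /sQ.
    by rewrite !inE eqxx.
have B2E : B2 = [set w in B :\ v | e v w == ~~ b].
  by apply/setP => w; rewrite !inE; case: (e v w); case: (b).
have sB1 : B1 \subset B by apply/subsetP => w; rewrite !inE => /andP[/andP[]].
have sB2 : B2 \subset B by apply/subsetP => w; rewrite !inE => /andP[/andP[]].
have [h1|h1] := ltnP (L.+1 ^ (k + l.+1)) (#|B1|.+1 * L ^ l.+1).
  case: (IH k l.+1 B1) => //.
    move=> [Q [sQ mQ cQ]]; left; have [? ? cvQ] := add_v _ _ mQ sQ.
    by exists (v |: Q); rewrite cvQ cQ.
  by move=> [Q [sQ mQ cQ]]; right; exists Q; split=> //; apply: subset_trans sB1.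
have [h2|h2] := ltnP (L.+1 ^ (k.+1 + l)) (#|B2|.+1 * L ^ l).
  case: (IH k.+1 l B2) => //; first by move: le_n; clear; lia.
    by move=> [Q [sQ mQ cQ]]; left; exists Q; split=> //; apply: subset_trans sB2.
  move=> [Q [sQ mQ cQ]]; right; rewrite B2E in sQ; have [? ? cvQ] := add_v _ _ mQ sQ.
  by exists (v |: Q); rewrite cvQ cQ.
exfalso; move: (leq_mul (leqnn L) h2) hB h1.
rewrite cB !addSn !addnS !expnS.
move: (L.+1 ^ (k + l))%N (L ^ l)%N #|B1| #|B2| => X Y a c.
clear; nia.
Qed.

(** Go through [P] one element at a time: if a fraction L/(L+1) of the
    current set is good for x, keep x and these vertices; otherwise drop x and
    keep the bad vertices, still a fraction 1/(L+1).  A surviving vertex is bad for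
    every dropped element, so at most [d] elements are dropped and the
    expensive factor is paid at most [d] times. *)
Lemma prune (A : eqType) (T : finType) (bad : T -> A -> bool) (L d : nat)
    (P : seq A) (B : {set T}) :
  {in B, forall w, count (bad w) P <= d}%N ->
  exists (P' : seq A) (B' : {set T}),
    [/\ subseq P' P, B' \subset B, (size P <= size P' + d)%N,
        {in B' & P', forall w x, ~~ bad w x}
      & (#|B| * L ^ size P <= #|B'| * L.+1 ^ (size P + d))%N].
Proof.
elim: P d B => [|x P IH] d B /= hB.
  exists [::], B; split=> //; rewrite expn0 muln1 add0n.
  by rewrite leq_pmulr // expn_gt0.
pose Bx := B :&: [set w | bad w x].
pose By := B :\: [set w | bad w x].
have cB : #|B| = (#|Bx| + #|By|)%N by rewrite cardsID.
have [h|h] := leqP (#|B| * L) (#|By| * L.+1).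
  case: (IH d By) => [w|P' [B' [s1 s2 s3 s4 s5]]].
    by rewrite !inE => /andP[nb wB]; have := hB _ wB; rewrite (negbTE nb).
  exists (x :: P'), B'; split=> //=.
  - by rewrite eqxx.
  - by apply: (subset_trans s2); apply: subsetDl.
  - move=> w y wB'; rewrite inE => /orP[/eqP->|yP]; last exact: s4.
    by have := subsetP s2 _ wB'; rewrite !inE => /andP[].
  - rewrite addSn !expnS.
    move: s5 h; move: (L ^ _)%N (L.+1 ^ _)%N #|B| #|B'| #|By| => X Y b b' by'; nia.
have Bx0 : (#|B| <= #|Bx| * L.+1)%N by nia.
case: d hB => [|d] hB.
  have Bx00 : #|Bx| = 0%N.
    apply/eqP; rewrite cards_eq0; apply/eqP/setP => w; rewrite !inE.
    apply/negP => /andP[wB wx]; have := hB _ wB; rewrite wx; lia.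
  by move: h; rewrite cB Bx00; nia.
case: (IH d Bx) => [w|P' [B' [s1 s2 s3 s4 s5]]].
  by rewrite !inE => /andP[wB wx]; have := hB _ wB; rewrite wx; lia.
exists P', B'; split=> //.
- exact: subseq_trans s1 (subseq_cons P x).
- by apply: (subset_trans s2); apply: subsetIl.
- by lia.
- rewrite addnS !addSn !expnS.
  move: s5 Bx0; move: (L ^ _)%N (L.+1 ^ _)%N #|B| #|B'| #|Bx| => X Y b b' bx s5 Bx0.
  apply: (@leq_trans (bx * L.+1 * (L.+1 * X))).
    by apply: leq_mul => //; rewrite leq_mul2r leqnSn orbT.
  have -> : (bx * L.+1 * (L.+1 * X) = L.+1 * L.+1 * (bx * X))%N by ring.
  have -> : (b' * (L.+1 * (L.+1 * Y)) = L.+1 * L.+1 * (b' * Y))%N by ring.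
  by rewrite leq_mul2l s5 orbT.
Qed.

Lemma pigeonhole_centers (T : finType) (U B : {set T}) (c : T -> T) (m : nat) :
  {in B, forall w, c w \in U} -> (#|U| < m)%N -> (0 < #|B|)%N ->
  exists u, (#|B| <= m * #|[set w in B | c w == u]|)%N.
Proof.
move=> cU Um B0.
pose S u := [set w in B | c w == u].
have [/existsP[u hu]|/existsPn h] := boolP [exists u, (#|B| <= m * #|S u|)%N].
  by exists u.
exfalso.
have E : #|B| = (\sum_(u in U) #|S u|)%N.
  rewrite -sum1_card (partition_big c (mem U)) //=.
  by apply: eq_bigr => u _; rewrite -sum1_card; apply: eq_bigl => w; rewrite inE.
have : (\sum_(u in U) m * #|S u| <= \sum_(u in U) #|B|)%N.
  by apply: leq_sum => u _; apply: ltnW; rewrite ltnNge; apply: h.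
rewrite -big_distrr /= -E sum_nat_const leq_pmul2r //; lia.
Qed.

(** Bernoulli's inequality (1 - 1/2K)^K >= 1/2, raised to the power [q]. *)
Lemma bernoulli_nat (K n q : nat) : (0 < K)%N -> (n <= K * q)%N ->
  ((2 * K) ^ n <= 2 ^ q * (2 * K).-1 ^ n)%N.
Proof.
move=> K0.
have bern L j : (L.+1 ^ j.+1 <= L.+1 * L ^ j + j * L.+1 ^ j)%N.
  elim: j => [|j IH]; first by rewrite !expn0 expn1; lia.
  rewrite expnS (expnS L j) (expnS L.+1 j); rewrite (expnS L.+1 j) in IH *.
  move: IH; move: (L.+1 ^ j)%N (L ^ j)%N => X Y; nia.
have bK : ((2 * K) ^ K <= 2 * (2 * K).-1 ^ K)%N.
  have := bern (2 * K).-1 K; rewrite prednK ?muln_gt0 // expnS.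
  move: ((2 * K) ^ K)%N ((2 * K).-1 ^ K)%N => X Y; nia.
move=> nKq; rewrite -(@leq_pmul2r ((2 * K).-1 ^ (K * q - n))); last first.
  by rewrite expn_gt0; lia.
rewrite -mulnA -expnD subnKC //.
apply: (@leq_trans ((2 * K) ^ (K * q))).
  rewrite -{2}(subnKC nKq) expnD leq_mul2l; apply/orP; right.
  by case: (K * q - n)%N => [|d]; rewrite ?expn0 // leq_exp2r // leq_pred.
by rewrite !expnM -expnMn; case: q {nKq} => [|q]; rewrite ?expn0 // leq_exp2r.
Qed.

Lemma exists_subset_card (T : finType) (U : {set T}) m : (m <= #|U|)%N ->
  exists2 V : {set T}, V \subset U & #|V| = m.
Proof.
move=> mU; exists [set x in take m (enum U)].
  by apply/subsetP => x; rewrite inE => /mem_take; rewrite mem_enum.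
rewrite cardsE (card_uniqP _) ?take_uniq ?enum_uniq //.
by rewrite size_takel // -cardE.
Qed.

(** * A Ramsey graph has many vertices with pairwise distant neighbourhoods *)

(** A pick (b, x) asks its later companions w to be joined to x if b is true
    and not joined if b is false; w = x is excluded as well, so that later
    picks are new. *)
Definition bad_for (T : finType) (e : rel T) (w : T) (p : bool * T) : bool :=
  (p.2 == w) || (e p.2 w != p.1).

(** The state of the greedy construction after [j] rounds: [P] holds the
    coloured picks and [V] the vertices still available.  A round adds [q]
    picks and loses at most half as many, and it halves [V] at worst; every pick is
    bad for only a small fraction of [V], because [V] follows the majority of
    the cluster centre of that pick. *)
Record greedy (T : finType) (e : rel T) (q D j : nat)
    (P : {set bool * T}) (V : {set T}) : Prop := Greedy {
  greedy_mono : forall b, mono e b [set x | (b, x) \in P];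
  greedy_large : (j * q <= 2 * #|P|)%N;
  greedy_small : (#|P| <= j * q)%N;
  greedy_bad : forall p, p \in P ->
    (D * #|[set w in V | bad_for e w p]| <= 2 * #|T|)%N;
  greedy_room : (#|T| <= 2 ^ j * #|V|)%N }.

Lemma sum_count_bad (T : finType) (e : rel T) (P : {set bool * T}) (V : {set T}) :
  (\sum_(w in V) #|[set p in P | bad_for e w p]| =
   \sum_(p in P) #|[set w in V | bad_for e w p]|)%N.
Proof.
have E (A B : finType) (X : {set A}) (Y : {set B}) (r : A -> B -> bool) :
    (\sum_(x in X) #|[set y in Y | r x y]| = \sum_(x in X) \sum_(y in Y) r x y)%N.
  apply: eq_bigr => x _; rewrite -sum1_card big_mkcond [RHS]big_mkcond /=.
  by apply: eq_bigr => y _; rewrite inE; case: (y \in Y); case: (r x y).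
by rewrite (E _ _ V P) (E _ _ P V (fun p w => bad_for e w p)) exchange_big.
Qed.

(** Double counting: each pick is bad for few vertices of [V], so few
    vertices are bad for more than half of [q] picks. *)
Lemma light_vertices (T : finType) (e : rel T) (q K j : nat) P V :
  (0 < K)%N -> (0 < q)%N -> (j < K)%N ->
  greedy e q (K * 2 ^ (K + 3)) j P V ->
  (#|T| <= 2 ^ K.+1 *
     #|[set w in V | #|[set p in P | bad_for e w p]| <= q./2]|)%N.
Proof.
move=> K0 q0 jK [_ _ gs gb gr].
set light := [set w in V | _].
pose heavy := V :\: light.
have cV : #|V| = (#|light| + #|heavy|)%N.
  by rewrite -(cardsID light V) (setIidPr _) //; apply/subsetP => w; rewrite inE => /andP[].
have h1 : (#|heavy| * q <= 2 * \sum_(p in P) #|[set w in V | bad_for e w p]|)%N.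
  rewrite -sum_count_bad (big_setID light) /= -/heavy.
  rewrite mulnDr; apply: leq_trans (leq_addl _ _).
  rewrite -sum_nat_const big_distrr /=; apply: leq_sum => w.
  by rewrite !inE => /andP[+ wV]; rewrite wV /=; lia.
have h2 : (K * 2 ^ (K + 3) * \sum_(p in P) #|[set w in V | bad_for e w p]|
           <= K * q * (2 * #|T|))%N.
  rewrite big_distrr /=.
  apply: (@leq_trans (\sum_(p in P) 2 * #|T|)); first exact: leq_sum.
  rewrite sum_nat_const leq_mul2r; apply/orP; right.
  by apply: (leq_trans gs); rewrite leq_mul2r; apply/orP; right; apply: ltnW.
have h3 : (2 ^ K.+1 * #|heavy| <= #|T|)%N.
  have : (K * 2 ^ (K + 3) * (#|heavy| * q) <= 2 * (K * q * (2 * #|T|)))%N.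
    by apply: leq_trans (leq_mul (leqnn 2) h2); rewrite [leqRHS]mulnCA leq_mul2l h1 orbT.
  have -> : (K * 2 ^ (K + 3) * (#|heavy| * q) =
     4 * (K * q) * (2 ^ K.+1 * #|heavy|))%N by rewrite expnD !expnS; ring.
  have -> : (2 * (K * q * (2 * #|T|)) = 4 * (K * q) * #|T|)%N by ring.
  by rewrite leq_pmul2l // !muln_gt0 K0 q0.
have h4 : (#|T| <= 2 ^ K * #|V|)%N.
  by apply: (leq_trans gr); rewrite leq_mul2r leq_exp2l ?(ltnW jK) ?orbT.
move: h3 h4; rewrite cV expnS; move: (2 ^ K)%N => X; lia.
Qed.

(** The light vertices fall into fewer than 16^t clusters, so one cluster
    contains at least 4^t of them up to a constant.  Pruning and the off-diagonal
    Ramsey bound cost only factors exponential in [q], which the numerical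
    hypothesis on 4^t absorbs.  The colour of the round is the majority colour, on [V], of the
    centre of the cluster: every member of the cluster follows that colour on all
    but few vertices. *)
Lemma greedy_step (T : finType) (e : rel T) (H K q t j : nat) (U : {set T})
    (ctr : T -> T) (P : {set bool * T}) (V : {set T}) :
  simple_graph e -> (0 < K)%N -> (0 < q)%N -> (H * t <= K * q)%N ->
  (2 ^ K.+1 * (4 * K) ^ q * (4 * K) ^ q <= 4 ^ t)%N ->
  (64 ^ t <= #|T|)%N -> (K * 2 ^ (K + 3) <= #|T|)%N ->
  (forall Q, homogeneous e Q -> #|Q| < H * t)%N ->
  (#|U| < 16 ^ t)%N -> (forall v, ctr v \in U) ->
  (forall v, K * 2 ^ (K + 3) * #|[set w | e v w != e (ctr v) w]| < #|T|)%N ->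
  (j < K)%N -> greedy e q (K * 2 ^ (K + 3)) j P V ->
  exists (P' : {set bool * T}) (V' : {set T}), greedy e q (K * 2 ^ (K + 3)) j.+1 P' V'.
Proof.
move=> [sym irr] K0 q0 HK ht hN DN hom Um ctrU near jK gr.
have := light_vertices K0 q0 jK gr; set light := [set w in V | _] => hl.
case: gr => gm gl gs gb gv.
have N0 : (0 < #|T|)%N by apply: leq_trans hN; rewrite expn_gt0.
have l0 : (0 < #|light|)%N.
  by move: (leq_trans N0 hl); rewrite muln_gt0 => /andP[].
have [u hu] := pigeonhole_centers (fun w _ => ctrU w) Um l0.
set B := [set w in light | ctr w == u] in hu.
have hB : (4 ^ t <= 2 ^ K.+1 * #|B|)%N.
  rewrite -(@leq_pmul2l (16 ^ t)) ?expn_gt0 // -expnMn.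
  apply: (leq_trans hN); apply: (leq_trans hl).
  by rewrite mulnCA leq_mul2l hu orbT.
case: (@prune _ T (bad_for e) (2 * K).-1 q./2 (enum P) B).
  move=> w; rewrite !inE => /andP[/andP[_ hw] _]; apply: leq_trans hw.
  rewrite cardE -size_filter; apply: eq_leq; apply/perm_size/uniq_perm.
  - exact/filter_uniq/enum_uniq.
  - exact: enum_uniq.
  - by move=> p; rewrite mem_filter !mem_enum !inE andbC.
move=> P1 [B' [sP1 sB' cP1 good]].
rewrite -cardE in cP1 *; rewrite prednK ?muln_gt0 // => hB'.
(* the majority colour of the centre [u] on [V] *)
pose b := (#|V| <= 2 * #|[set w in V | e u w]|)%N.
pose V' := [set w in V | e u w == b].
have cV' : (#|V| <= 2 * #|V'|)%N.
  rewrite /V'; case: (boolP b) => hb.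
    apply: (leq_trans hb); rewrite leq_mul2l; apply/orP; right.
    by apply: subset_leq_card; apply/subsetP => w; rewrite !inE eqb_id.
  move: hb; rewrite /b -ltnNge -(cardsID [set w | e u w] V).
  have -> : V :&: [set w | e u w] = [set w in V | e u w] by apply/setP => w; rewrite !inE.
  have -> : V :\: [set w | e u w] = [set w in V | e u w == false].
    by apply/setP => w; rewrite !inE andbC eqbF_neg.
  lia.
have KK0 : (0 < (2 * K).-1)%N by lia.
have cB' : (2 ^ q * (2 * K) ^ q <= #|B'|)%N.
  have hPq : (#|P| <= K * q)%N by apply: (leq_trans gs); rewrite leq_mul2r (ltnW jK) orbT.
  have h1 := bernoulli_nat K0 hPq.
  have h2 : (#|B| <= #|B'| * (2 ^ q * (2 * K) ^ q))%N.
    rewrite -(@leq_pmul2r ((2 * K).-1 ^ #|P|)) ?expn_gt0 ?KK0 //.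
    apply: (leq_trans hB'); rewrite -mulnA leq_mul2l; apply/orP; right.
    rewrite expnD mulnAC leq_mul // leq_exp2l; lia.
  have : (2 ^ K.+1 * (2 ^ q * (2 * K) ^ q) * (2 ^ q * (2 * K) ^ q)
           <= 2 ^ K.+1 * (#|B'| * (2 ^ q * (2 * K) ^ q)))%N.
    have E : ((4 * K) ^ q = 2 ^ q * (2 * K) ^ q)%N by rewrite -expnMn mulnA.
    rewrite -E in h2 *; apply: (leq_trans ht); apply: (leq_trans hB).
    by rewrite leq_mul2l h2 orbT.
  rewrite -[(2 ^ K.+1 * _ * _)%N]mulnA leq_pmul2l ?expn_gt0 //.
  by rewrite leq_pmul2r // -expnMn expn_gt0 !muln_gt0 K0.
have [Q sQ [mQ cQ]] : exists2 Q : {set T}, Q \subset B' & mono e b Q /\ #|Q| = q.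
  case: (@off_diagonal T e b (2 * K).-1 q (H * t) B' sym KK0).
  - rewrite prednK ?muln_gt0 // expnD.
    apply: (@leq_ltn_trans (#|B'| * (2 * K).-1 ^ (H * t))); last first.
      by rewrite ltn_pmul2r ?expn_gt0 ?KK0.
    apply: (@leq_trans ((2 * K) ^ q * (2 ^ q * (2 * K).-1 ^ (H * t)))).
      by rewrite leq_mul2l (bernoulli_nat K0 HK) orbT.
    by rewrite mulnA leq_mul2r [X in (X <= _)%N]mulnC cB' orbT.
  - by move=> [Q [? ? ?]]; exists Q.
  - move=> [Q [_ mQ cQ]]; have := hom _ (mono_homogeneous irr mQ).
    by rewrite cQ ltnn.
pose P1s := [set p in P1].
have sP1s p : p \in P1s -> p \in P.
  by rewrite inE => /(mem_subseq sP1); rewrite mem_enum.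
have cP1s : #|P1s| = size P1.
  by rewrite cardsE; apply/card_uniqP; apply: subseq_uniq sP1 (enum_uniq _).
have goodQ c x y : (c, x) \in P1s -> y \in Q -> x != y /\ e x y = c.
  rewrite inE => xP yQ; have := good _ _ (subsetP sQ _ yQ) xP.
  by rewrite /bad_for /= negb_or negbK => /andP[? /eqP].
have inPQ c x : ((c, x) \in P1s :|: [set (b, y) | y in Q]) ->
    (c, x) \in P1s \/ (c = b /\ x \in Q).
  by rewrite in_setU => /orP[|/imsetP[y yQ [-> ->]]]; [left|right].
exists (P1s :|: [set (b, x) | x in Q]), V'.
have cPQ : #|P1s :|: [set (b, x) | x in Q]| = (size P1 + q)%N.
  rewrite cardsU cP1s card_imset ?cQ; last by move=> x y [].
  suff -> : P1s :&: [set (b, x) | x in Q] = set0 by rewrite cards0 subn0.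
  apply/setP => p; rewrite in_setI in_set0; apply/negP => /andP[pP /imsetP[x xQ E]].
  by move: pP; rewrite E => /goodQ /(_ xQ); rewrite eqxx; case.
split.
- move=> c x y; rewrite inE => /inPQ hx; rewrite inE => /inPQ hy nxy.
  case: hx => [xP|[E xQ]]; case: hy => [yP|[_ yQ]].
  + by apply: (gm c) => //; rewrite inE; apply: sP1s.
  + by have [] := goodQ _ _ _ xP yQ.
  + by rewrite sym; have [] := goodQ _ _ _ yP xQ.
  + by rewrite E; apply: mQ.
- move: (leq_trans gl (leq_mul (leqnn 2) cP1)); rewrite cPQ mulSn; clear; lia.
- by rewrite cPQ mulSn addnC leq_add2l; apply: leq_trans gs; rewrite cardE; apply: size_subseq.
- move=> [c x] /inPQ[xP|[-> xQ]].
    apply: leq_trans (gb _ (sP1s _ xP)); rewrite leq_mul2l; apply/orP; right.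
    by apply: subset_leq_card; apply/subsetP => w; rewrite !inE => /andP[/andP[-> _] ->].
  have := subsetP sB' _ (subsetP sQ _ xQ); rewrite inE => /andP[_ /eqP cx].
  have : (#|[set w in V' | bad_for e w (b, x)]| <=
          1 + #|[set w | e x w != e (ctr x) w]|)%N.
    rewrite -(cards1 x); apply: leq_trans (leq_card_setU _ _).
    apply: subset_leq_card; apply/subsetP => w; rewrite !inE /bad_for /=.
    by move=> /andP[/andP[_ /eqP ub]]; rewrite cx ub eq_sym.
  move=> hm; apply: leq_trans (leq_mul (leqnn _) hm) _.
  by rewrite mulnDr muln1 mul2n -addnn leq_add // ltnW.
- by apply: (leq_trans gv); rewrite expnS -mulnA mulnCA leq_mul2l cV' orbT.
Qed.

Definition separated (T : finType) (e : rel T) (D : nat) (U : {set T}) : bool :=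
  [forall u in U, forall v in U,
     (u != v) ==> (#|T| <= D * #|[set w | e u w != e v w]|)%N].

Lemma separatedP (T : finType) (e : rel T) D (U : {set T}) :
  reflect {in U &, forall u v, u != v ->
            (#|T| <= D * #|[set w | e u w != e v w]|)%N} (separated e D U).
Proof.
apply: (iffP 'forall_implyP) => h u.
  by move=> v uU vU; have /'forall_implyP/(_ _ vU)/implyP := h u uU.
by move=> uU; apply/'forall_implyP => v vU; apply/implyP; apply: h.
Qed.

(** A separated set of maximum size is a set of centres for all vertices. *)
Lemma separated_centers (T : finType) (e : rel T) (D m : nat) :
  (0 < #|T|)%N ->
  (exists2 U : {set T}, #|U| = m & separated e D U) \/
  (exists2 U : {set T}, (#|U| < m)%N & exists2 ctr : T -> T, forall v, ctr v \in U &
     forall v, (D * #|[set w | e v w != e (ctr v) w]| < #|T|)%N).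
Proof.
move=> N0.
have sep0 : separated e D set0 by apply/separatedP => x y; rewrite inE.
case: (@arg_maxnP _ set0 (separated e D) (fun U => #|U|) sep0) => U sU maxU.
have [mU|Um] := leqP m #|U|.
  left; have [W sWU cW] := exists_subset_card mU.
  exists W => //; apply/separatedP => x y /(subsetP sWU) xU /(subsetP sWU) yU.
  exact: (separatedP _ _ _ sU).
right; exists U => //.
have near v : exists u, (u \in U) && (D * #|[set w | e v w != e u w]| < #|T|)%N.
  have [/existsP//|/existsPn far] := boolP [exists u, (u \in U) && (D * #|[set w | e v w != e u w]| < #|T|)%N].
  have vU : v \notin U.
    apply/negP => vU; have := far v; suff -> : [set w | e v w != e v w] = set0.
      by rewrite vU cards0 muln0 N0.
    by apply/setP => w; rewrite !inE eqxx.
  have {}far u : u \in U -> (#|T| <= D * #|[set w | e v w != e u w]|)%N.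
    by move=> uU; have := far u; rewrite uU /= -leqNgt.
  suff /maxU : separated e D (v |: U) by rewrite /geq /= cardsU1 vU add1n ltnn.
  apply/separatedP => x y /setU1P[->|xU] /setU1P[->|yU]; rewrite ?eqxx // => nxy.
  - exact: far.
  - suff -> : [set w | e x w != e v w] = [set w | e v w != e x w] by exact: far.
    by apply/setP => w; rewrite !inE eq_sym.
  - exact: (separatedP _ _ _ sU).
by exists (fun v => xchoose (near v)) => v; have /andP[] := xchooseP (near v).
Qed.

(** The homogeneous sets have fewer than H t elements, which is C log N for a
    suitable H.  Each of the K = 8 H A rounds yields at least q/2 picks, where q is about
    t/A; half of these in one colour make at least H t.  The constant A is
    chosen so that 2^A exceeds the losses per pick. *)
Lemma separated_of_ramsey (H : nat) : exists D t0 : nat, (0 < D)%N /\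
  forall (T : finType) (e : rel T) (t : nat),
    simple_graph e -> (t0 <= t)%N -> (64 ^ t <= #|T|)%N ->
    (forall Q : {set T}, homogeneous e Q -> #|Q| < H * t)%N ->
    exists2 U : {set T}, #|U| = (16 ^ t)%N & separated e D U.
Proof.
have [->|H0] := posnP H.
  exists 1%N, 0%N; split=> // T e t _ _ _ hom.
  have := hom set0; rewrite cards0 mul0n ltnn => /(_ _); case/(_ _)/notF.
  by apply/orP; left; apply/'forall_implyP => x; rewrite inE.
pose A := (2 * H + 10)%N; pose K := (8 * H * A)%N.
have A0 : (0 < A)%N by rewrite /A; lia.
have K0 : (0 < K)%N by rewrite !muln_gt0 H0.
have hA : (8 * K <= 2 ^ A)%N.
  have hpow n : (n.+1 <= 2 ^ n)%N by exact: ltn_expl.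
  rewrite /K /A expnD (expnM 2 2 H) (_ : 2 ^ 10 = 1024)%N //.
  have : (H.+1 * H.+1 <= (2 ^ 2) ^ H)%N.
    by rewrite (expnMn 2 2 H) leq_mul.
  move: ((2 ^ 2) ^ H)%N => X; clear; nia.
(* rounds lose a factor at most 2^K of room in total, and the picks, at most K q
   of them, together spoil at most half of the vertices that remain *)
exists (K * 2 ^ (K + 3))%N, (A * (K * 2 ^ (K + 3)))%N.
have D0 : (0 < K * 2 ^ (K + 3))%N by rewrite muln_gt0 K0 expn_gt0.
split=> // T e t sg ht hN hom.
have N0 : (0 < #|T|)%N by apply: leq_trans hN; rewrite expn_gt0.
case: (@separated_centers T e (K * 2 ^ (K + 3)) (16 ^ t) N0) => // -[U Um [ctr cU near]].
exfalso.
pose q := (t %/ A)%N.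
have hq : (K * 2 ^ (K + 3) <= q)%N by rewrite leq_divRL // mulnC.
have q0 : (0 < q)%N by apply: leq_trans hq.
have tA : (A * q <= t)%N by rewrite mulnC leq_trunc_div.
have tA2 : (t < A * q.+1)%N by rewrite mulnC -ltn_divLR.
have Kq : (K < q)%N.
  apply: leq_trans hq; rewrite -[X in (X < _)%N]muln1 ltn_pmul2l //.
  by rewrite -[X in (X < _)%N](expn0 2) ltn_exp2l // addn3.
have Ht : (4 * (H * t) <= K * q)%N.
  have tAq : (t <= 2 * (A * q))%N.
    apply: ltnW; apply: (leq_trans tA2); rewrite mulnS mul2n -addnn leq_add2r.
    exact: leq_pmulr.
  have -> : (K * q = 4 * (H * (2 * (A * q))))%N by rewrite /K; ring.
  by rewrite !leq_mul2l tAq !orbT.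
have step j : (j <= K)%N -> exists P V, greedy e q (K * 2 ^ (K + 3)) j P V.
  elim: j => [_|j IH jK].
    exists set0, setT; split=> //.
    - by move=> b x y; rewrite !inE.
    - by rewrite cards0.
    - by move=> p; rewrite inE.
    - by rewrite mul1n cardsT.
  have [P [V gPV]] := IH (ltnW jK).
  apply: (greedy_step (H := H) (t := t) (U := U) (ctr := ctr) sg K0 q0 _ _ hN _ hom Um cU near jK gPV).
  - by apply: leq_trans Ht; apply: leq_pmull.
  - apply: (@leq_trans (4 ^ q * (4 * K) ^ q * (4 * K) ^ q)).
      rewrite !leq_mul2r; apply/orP; right; apply/orP; right.
      by rewrite -[4%N]/(2 ^ 2)%N -expnM leq_exp2l //; move: Kq; clear; lia.
    apply: (@leq_trans (4 ^ (A * q))); last by rewrite leq_exp2l.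
    have E : (4 ^ A = 2 ^ A * 2 ^ A)%N by rewrite -expnMn.
    rewrite (expnM 4) -!expnMn leq_exp2r // E.
    apply: leq_trans (leq_mul hA hA).
    by apply: eq_leq; ring.
  - apply: (leq_trans hq); apply: leq_trans hN.
    apply: (@leq_trans t); last by apply/ltnW/ltn_expl.
    exact: leq_div.
have [P [V [gm gl _ _ _]]] := step K (leqnn K).
have cP : (#|P| <= #|[set x | (true, x) \in P]| + #|[set x | (false, x) \in P]|)%N.
  have cb b : #|[set x | (b, x) \in P]| = #|[set p in P | p.1 == b]|.
    rewrite -(card_imset _ (_ : injective (pair b))); last by move=> x y [].
    apply: eq_card => -[c x]; rewrite !inE.
    apply/imsetP/andP => [[y + [-> ->]]|[cx /eqP/= <-]]; first by rewrite inE /= eqxx.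
    by exists x => //; rewrite inE.
  rewrite !cb -(cardsID [set p | p.1] P); apply: leq_add; apply: subset_leq_card;
  by apply/subsetP => -[[] x]; rewrite !inE ?andbT ?andbF.
have small b := hom _ (mono_homogeneous (proj2 sg) (gm b)).
by move: (small true) (small false) gl cP Ht; clear; lia.
Qed.

(** * Random subsequences and their sums *)

Lemma bin_le_half n k : ('C(n, k) <= 'C(n, n./2))%N.
Proof.
have up j : (j.*2 < n)%N -> ('C(n, j) <= 'C(n, j.+1))%N.
  move=> hj; rewrite -(@leq_pmul2l j.+1) // mul_bin_left leq_mul2r.
  by apply/orP; right; lia.
have low d : (d <= n./2)%N -> ('C(n, n./2 - d) <= 'C(n, n./2))%N.
  elim: d => [|d IH] hd; first by rewrite subn0.
  apply: leq_trans (IH (ltnW hd)).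
  have -> : (n./2 - d = (n./2 - d.+1).+1)%N by lia.
  by apply: up; lia.
have [hk|hk] := leqP k n./2; first by rewrite -(subKn hk) low // leq_subr.
have [kn|kn] := leqP k n; last by rewrite bin_small.
rewrite -bin_sub // (_ : n - k = n./2 - (n./2 - (n - k)))%N; last by lia.
by apply: low; rewrite leq_subr.
Qed.

(** A binomial probability is at most 1/sqrt(n+1).  The central coefficient
    suffices, and there the quotient of consecutive terms is at most 1. *)
Lemma bin_sqr_le n k : ('C(n, k) ^ 2 * n.+1 <= 4 ^ n)%N.
Proof.
apply: (@leq_trans ('C(n, n./2) ^ 2 * n.+1)).
  by rewrite leq_mul2r leq_exp2r // bin_le_half orbT.
have oddE m : ('C(m.*2.+2, m.+1) = 2 * 'C(m.*2.+1, m))%N.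
  rewrite binS -(bin_sub (_ : m.+1 <= m.*2.+1)%N); last by lia.
  rewrite (_ : m.*2.+1 - m.+1 = m)%N; last by lia.
  by rewrite mul2n addnn.
have central m : ('C(m.*2, m) ^ 2 * m.*2.+1 <= 4 ^ m.*2)%N.
  elim: m => [|m IH]; first by rewrite bin0.
  rewrite doubleS oddE.
  have h : (m.+1 * 'C(m.*2.+1, m) = m.*2.+1 * 'C(m.*2, m))%N.
    rewrite -(bin_sub (_ : m <= m.*2.+1)%N); last by lia.
    rewrite (_ : m.*2.+1 - m = m.+1)%N; last by lia.
    by rewrite -mul_bin_diag.
  rewrite -(@leq_pmul2l (m.+1 ^ 2)) ?expn_gt0 //.
  have -> : (m.+1 ^ 2 * ((2 * 'C(m.*2.+1, m)) ^ 2 * m.*2.+3) =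
     4 * (m.+1 * 'C(m.*2.+1, m)) ^ 2 * m.*2.+3)%N by ring.
  rewrite h -mul2n !expnS.
  rewrite -mul2n !expnS in IH.
  move: ('C(2 * m, m)) (4 ^ (2 * m))%N IH => c X IH.
  have -> : (4 * ((2 * m).+1 * c * ((2 * m).+1 * c * c ^ 0)) * (2 * m).+3 =
     4 * ((2 * m).+1 * (2 * m).+3) * (c * c * (2 * m).+1))%N by rewrite expn0; ring.
  apply: (@leq_trans (4 * ((2 * m).+1 * (2 * m).+3) * X)).
    by rewrite leq_mul2l; apply/orP; right; move: IH; rewrite expn0 muln1.
  have : ((2 * m).+1 * (2 * m).+3 <= 4 * (m.+1 * m.+1))%N by lia.
  rewrite expn0 muln1; move: ((2 * m).+1 * (2 * m).+3)%N (m.+1 * m.+1)%N => a b ab.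
  have -> : (b * (4 * (4 * X)) = 4 * (4 * b) * X)%N by ring.
  by rewrite leq_mul2r leq_mul2l ab !orbT.
have := odd_double_half n; move: (n./2) => m; case: (odd n) => <- /=.
  have := central m.+1; rewrite doubleS oddE add1n !expnS.
  move: ('C(m.*2.+1, m)) (4 ^ m.*2)%N => c X; nia.
by rewrite add0n.
Qed.

(** Binomial coefficients with an integer lower index, so that Pascal's rule
    needs no side condition. *)
Definition binz (n : nat) (z : int) : nat := if z is Posz k then 'C(n, k) else 0%N.

Lemma binzS n z : binz n.+1 z = (binz n z + binz n (z - 1))%N.
Proof.
case: z => [[|k]|k].
- by rewrite (_ : 0%:Z - 1 = Negz 0) //= !bin0.
- by rewrite (_ : k.+1%:Z - 1 = k%:Z) /= ?binS //; lia.
- by rewrite (_ : Negz k - 1 = Negz k.+1) //; lia.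
Qed.

Lemma binz_sqr_le n z : (binz n z ^ 2 * n.+1 <= 4 ^ n)%N.
Proof. by case: z => k /=; rewrite ?bin_sqr_le. Qed.

Section Expectation.
Variables (R : realFieldType) (T : eqType) (p : T -> R).

(** The expectation of [F] over a random subsequence of [s] that keeps each
    x independently with probability [p x].  The recursion on [s]
    makes conditioning on a block of [s] a mere concatenation. *)
Fixpoint expect (s : seq T) (F : seq T -> R) : R :=
  if s is x :: s' then
    p x * expect s' (fun l => F (x :: l)) + (1 - p x) * expect s' F
  else F [::].

Lemma eq_expect s F G : F =1 G -> expect s F = expect s G.
Proof.
elim: s F G => [|x s IH] F G FG /=; first exact: FG.
by congr (_ * _ + _ * _); apply: IH => l; apply: FG.
Qed.

Lemma expectD s F G : expect s (fun l => F l + G l) = expect s F + expect s G.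
Proof.
elim: s F G => [//|x s IH] F G /=.
rewrite (IH (fun l => F (x :: l))) IH; ring.
Qed.

Lemma expectZ s c F : expect s (fun l => c * F l) = c * expect s F.
Proof.
elim: s F => [//|x s IH] F /=.
rewrite (IH (fun l => F (x :: l))) IH; ring.
Qed.

Lemma expect_cst s c : expect s (fun _ => c) = c.
Proof. elim: s => [//|x s IH] /=; rewrite IH; ring. Qed.

Lemma expect_sum (I : Type) (r : seq I) (Q : pred I) s (F : I -> seq T -> R) :
  expect s (fun l => \sum_(i <- r | Q i) F i l) = \sum_(i <- r | Q i) expect s (F i).
Proof.
elim: r => [|i r IH].
  under eq_expect do rewrite big_nil.
  by rewrite big_nil expect_cst.
under eq_expect do rewrite big_cons.
rewrite big_cons; case: (Q i) => //.
by rewrite expectD IH.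
Qed.

Lemma expect_cat s1 s2 F :
  expect (s1 ++ s2) F = expect s1 (fun l1 => expect s2 (fun l2 => F (l1 ++ l2))).
Proof.
elim: s1 F => [//|x s1 IH] F /=.
by congr (_ * _ + _ * _); rewrite IH.
Qed.

(** Fubini for two independent blocks. *)
Lemma expect_swap s1 s2 (F : seq T -> seq T -> R) :
  expect s1 (fun l1 => expect s2 (fun l2 => F l1 l2)) =
  expect s2 (fun l2 => expect s1 (fun l1 => F l1 l2)).
Proof.
elim: s1 F => [//|x s1 IH] F /=.
by rewrite (IH (fun l1 => F (x :: l1))) IH -!expectZ -expectD.
Qed.

Definition probs (s : seq T) := {in s, forall x, 0 <= p x <= 1}.

Lemma probs_cons x s : probs (x :: s) -> 0 <= p x <= 1 /\ probs s.
Proof.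
by move=> h; split=> [|y ys]; apply: h; rewrite inE ?eqxx // ys orbT.
Qed.

Lemma le_expect s F G : probs s -> (forall l, F l <= G l) -> expect s F <= expect s G.
Proof.
elim: s F G => [|x s IH] F G /= ps FG; first exact: FG.
have [/andP[p0 p1] {}ps] := probs_cons ps.
by apply: lerD; apply: ler_wpM2l; rewrite ?subr_ge0 //; apply: IH.
Qed.

Lemma expect_exists s F : probs s -> exists2 l, subseq l s & F l <= expect s F.
Proof.
elim: s F => [|x s IH] F ps /=; first by exists [::].
have [/andP[p0 p1] {}ps] := probs_cons ps.
have [l1 s1 h1] := IH (fun l => F (x :: l)) ps.
have [l2 s2 h2] := IH F ps.
have [h|h] := leP (F (x :: l1)) (F l2).
  by exists (x :: l1); rewrite /= ?eqxx //; nra.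
exists l2; first exact: subseq_trans s2 (subseq_cons s x).
by nra.
Qed.

Definition mean (a : T -> R) (s : seq T) : R := \sum_(x <- s) a x * p x.

Lemma expect_dev a s : expect s (fun l => \sum_(x <- l) a x - mean a s) = 0.
Proof.
elim: s => [|x s IH] /=; first by rewrite /mean !big_nil subrr.
pose dev l := \sum_(j <- l) a j - mean a s.
rewrite (@eq_expect s (fun l => _ - _) (fun l => (1 - p x) * a x + dev l)); last first.
  by move=> l; rewrite /mean !big_cons -/(mean a s) /dev; ring.
rewrite [X in _ + _ * X](@eq_expect s _ (fun l => - (p x * a x) + dev l)); last first.
  by move=> l; rewrite /mean big_cons -/(mean a s) /dev; ring.
have {}IH : expect s dev = 0 := IH.
rewrite (expectD s (fun _ => (1 - p x) * a x) dev) (expectD s (fun _ => - (p x * a x)) dev).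
rewrite !expect_cst IH; ring.
Qed.

Lemma expect_var a s :
  expect s (fun l => (\sum_(x <- l) a x - mean a s) ^+ 2) =
  \sum_(x <- s) a x ^+ 2 * (p x * (1 - p x)).
Proof.
elim: s => [|x s IH] /=; first by rewrite /mean !big_nil subrr expr0n.
pose dev l := \sum_(j <- l) a j - mean a s.
rewrite (@eq_expect s (fun l => _ ^+ 2)
  (fun l => ((1 - p x) * a x) ^+ 2 + ((2 * (1 - p x) * a x) * dev l + dev l ^+ 2))); last first.
  by move=> l; rewrite big_cons /mean big_cons -/(mean a s) /dev; ring.
rewrite [X in _ + _ * X](@eq_expect s _
  (fun l => (p x * a x) ^+ 2 + ((- (2 * p x * a x)) * dev l + dev l ^+ 2))); last first.
  by move=> l; rewrite /mean big_cons -/(mean a s) /dev; ring.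
have {}IH : expect s (fun l => dev l ^+ 2) = \sum_(x <- s) a x ^+ 2 * (p x * (1 - p x)) := IH.
have dev0 : expect s dev = 0 := expect_dev a s.
have step c d : expect s (fun l => c + (d * dev l + dev l ^+ 2)) =
    c + expect s (fun l => dev l ^+ 2).
  rewrite (expectD s (fun _ => c)) (expectD s (fun l => d * dev l)).
  by rewrite expect_cst (expectZ s d dev) dev0 mulr0 add0r.
rewrite !step IH big_cons; ring.
Qed.

Lemma expect_var_le a s : probs s -> {in s, forall x, a x ^+ 2 <= 1} ->
  expect s (fun l => (\sum_(x <- l) a x - mean a s) ^+ 2) <= (size s)%:R / 4.
Proof.
rewrite expect_var; elim: s => [|x s IH] ps as1; first by rewrite big_nil mul0r.
have [/andP[p0 p1] {}ps] := probs_cons ps.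
rewrite big_cons /=.
have /IH{IH} := ps => /(_ _) IH.
have {IH} : \sum_(j <- s) a j ^+ 2 * (p j * (1 - p j)) <= (size s)%:R / 4.
  by apply: IH => y ys; apply: as1; rewrite inE ys orbT.
have : a x ^+ 2 <= 1 by apply: as1; rewrite inE eqxx.
have : 0 <= a x ^+ 2 by exact: sqr_ge0.
have : p x * (1 - p x) <= 1 / 4 by have := sqr_ge0 (p x - 1 / 2); lra.
have : 0 <= p x * (1 - p x) by rewrite mulr_ge0 // subr_ge0.
rewrite -natr1; move: (p x * _) (a x ^+ 2) (\sum_(_ <- _) _) => u v w.
nra.
Qed.

End Expectation.

Lemma addr_eq_subr (V : zmodType) (x y z : V) : (x + y == z) = (y == z - x).
Proof. by rewrite [RHS]eq_sym subr_eq eq_sym addrC. Qed.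

Lemma le_of_eq (R : numDomainType) (x y : R) : x = y -> x <= y.
Proof. by move=> ->. Qed.

Section PointBounds.
Variables (R : realFieldType) (T : eqType).
Implicit Types (p : T -> R) (a : T -> int) (s : seq T) (x : int).

Definition point p a s x : R := expect p s (fun l => (\sum_(w <- l) a w == x)%:R).

(** A sum of fair signs is a shifted binomial variable: an element of weight
    -1 that is kept acts like an element of weight 1 that is left out, up to
    a shift by 1. *)
Lemma fair_point_binz p a s x :
  {in s, forall w, p w = 2^-1} -> {in s, forall w, `|a w| <= 1} ->
  point p a s x =
  (binz (count (fun w => a w != 0) s) (x + (count (fun w => a w == -1) s)%:Z))%:R
    / 2 ^+ count (fun w => a w != 0) s.
Proof.
rewrite /point; elim: s x => [|w s IH] x hp ha /=.
  rewrite big_nil addr0 expr0 divr1 eq_sym.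
  by case: x => [[|k]|k].
have {}IH y : expect p s (fun l => (\sum_(w <- l) a w == y)%:R) =
  (binz (count (fun w => a w != 0) s) (y + (count (fun w => a w == -1) s)%:Z))%:R
    / 2 ^+ count (fun w => a w != 0) s.
  by apply: IH => v vs; [apply: hp|apply: ha]; rewrite inE vs orbT.
have E : (fun l => (\sum_(v <- w :: l) a v == x)%:R) =1
         (fun l => (\sum_(v <- l) a v == x - a w)%:R) :> (seq T -> R).
  by move=> l; rewrite big_cons addr_eq_subr.
rewrite (eq_expect _ _ E) !IH hp ?inE ?eqxx //.
set n := count _ s; set m := count _ s.
have : a w \in [:: -1; 0; 1].
  by have := ha w (mem_head _ _); rewrite !inE; lia.
rewrite !inE => /or3P[] /eqP ->.
- rewrite /= add1n exprS binzS opprK.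
  rewrite (_ : x + (1 + m)%N%:Z = x + 1 + m%:Z); last by lia.
  rewrite (_ : x + 1 + m%:Z - 1 = x + m%:Z); last by lia.
  rewrite natrD; field; rewrite ?expf_neq0 ?pnatr_eq0 //.
- by rewrite subr0 /= !add0n -/n -/m; field; rewrite ?expf_neq0 ?pnatr_eq0 //.
- rewrite /= add1n exprS binzS add0n.
  rewrite (_ : x - 1 + m%:Z = x + m%:Z - 1); last by lia.
  rewrite natrD; field; rewrite ?expf_neq0 ?pnatr_eq0 //.
Qed.

Lemma fair_point_le p a s x (beta : R) :
  {in s, forall w, p w = 2^-1} -> {in s, forall w, `|a w| <= 1} ->
  0 <= beta -> 1 <= beta ^+ 2 * (count (fun w => a w != 0) s).+1%:R ->
  point p a s x <= beta.
Proof.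
move=> hp ha b0 hb; rewrite fair_point_binz //.
set n := count _ _ in hb *; set z := (_ + _)%Z.
rewrite -(@ler_pXn2r _ 2) ?nnegrE //; last first.
  by rewrite divr_ge0 // exprn_ge0.
rewrite expr_div_n ler_pdivrMr ?exprn_gt0 // -(ler_pM2r (_ : 0 < n.+1%:R :> R)) ?ltr0n //.
have := binz_sqr_le n z; rewrite -(ler_nat R) natrM !natrX => h.
apply: (le_trans h).
have -> : (2 ^+ n) ^+ 2 = 4 ^+ n :> R by rewrite -exprM mulnC exprM -natrX.
by rewrite mulrAC -[leLHS]mul1r; apply: ler_wpM2r; rewrite ?exprn_ge0.
Qed.

(** Condition on the first block: for each of its outcomes the second block has
    to hit one point. *)
Lemma point_cat_le p a s1 s2 beta x : probs p s1 ->
  (forall y, point p a s2 y <= beta) -> point p a (s1 ++ s2) x <= beta.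
Proof.
move=> ps1 h; rewrite /point expect_cat -[leRHS](expect_cst p s1); apply: le_expect => // l1.
apply: le_trans (h (x - \sum_(w <- l1) a w)); apply: le_of_eq; apply: eq_expect => l2.
by rewrite big_cat addr_eq_subr.
Qed.

(** On the event that the sum equals [x], the deviation of [x] from the mean is the
    sum of the deviations of the two blocks.  The square of the deviation of one
    block is weighted by the point probability of the other block, which is at
    most [beta], so the event has probability at most [beta] and, times the
    squared deviation, at most a constant times [beta] times the variance. *)
Lemma point_le_quadratic p a s1 s2 (beta V : R) x :
  probs p s1 -> probs p s2 -> 0 < V -> (size s1 + size s2)%:R <= V ->
  {in s1 ++ s2, forall w, `|a w| <= 1} ->
  (forall y, point p a s1 y <= beta) -> (forall y, point p a s2 y <= beta) ->
  point p a (s1 ++ s2) x <=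
    2 * beta / (1 + (x%:~R - mean p (fun w => (a w)%:~R) (s1 ++ s2)) ^+ 2 / V).
Proof.
move=> ps1 ps2 V0 hV ha h1 h2.
set mu := mean _ _ _; pose b w : R := (a w)%:~R.
have muE : mu = mean p b s1 + mean p b s2 by rewrite /mu /mean big_cat.
have b0 : 0 <= beta.
  apply: le_trans (h1 0); rewrite -[leLHS](expect_cst p s1).
  by apply: le_expect => // l; rewrite ler0n.
pose dev s l := \sum_(w <- l) b w - mean p b s.
have sumb l : (\sum_(w <- l) a w)%:~R = \sum_(w <- l) b w by rewrite rmorph_sum.
have hb s : {subset s <= s1 ++ s2} -> {in s, forall w, b w ^+ 2 <= 1}.
  move=> sub w /sub /ha; rewrite /b => aw; rewrite -rmorphXn /= (ler_int _ _ 1).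
  by rewrite -(real_normK (num_real (a w))) exprn_ile1.
have hs1 : {subset s1 <= s1 ++ s2} by move=> w; rewrite mem_cat => ->.
have hs2 : {subset s2 <= s1 ++ s2} by move=> w; rewrite mem_cat orbC => ->.
have v1 := expect_var_le ps1 (hb _ hs1).
have v2 := expect_var_le ps2 (hb _ hs2).
pose hit l1 l2 : R := (\sum_(w <- l1 ++ l2) a w == x)%:R.
have P1 : point p a (s1 ++ s2) x <= beta by apply: point_cat_le.
have D1 : expect p s1 (fun l1 => expect p s2 (fun l2 => dev s1 l1 ^+ 2 * hit l1 l2))
    <= beta * ((size s1)%:R / 4).
  apply: le_trans (ler_wpM2l b0 v1); rewrite -expectZ; apply: le_expect => // l1.
  rewrite expectZ mulrC; apply: ler_wpM2r; first exact: sqr_ge0.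
  apply: le_trans (h2 (x - \sum_(w <- l1) a w)); apply: le_of_eq; apply: eq_expect => l2.
  by rewrite /hit big_cat addr_eq_subr.
have D2 : expect p s1 (fun l1 => expect p s2 (fun l2 => dev s2 l2 ^+ 2 * hit l1 l2))
    <= beta * ((size s2)%:R / 4).
  rewrite expect_swap.
  apply: le_trans (ler_wpM2l b0 v2); rewrite -expectZ; apply: le_expect => // l2.
  rewrite expectZ mulrC; apply: ler_wpM2r; first exact: sqr_ge0.
  apply: le_trans (h1 (x - \sum_(w <- l2) a w)); apply: le_of_eq; apply: eq_expect => l1.
  by rewrite /hit big_cat /= addrC addr_eq_subr.
have D : (x%:~R - mu) ^+ 2 * point p a (s1 ++ s2) x <= beta * V.
  apply: (@le_trans _ _ (2 * (beta * ((size s1)%:R / 4)) + 2 * (beta * ((size s2)%:R / 4)))).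
    apply: le_trans (lerD (ler_wpM2l (ler0n R 2) D1) (ler_wpM2l (ler0n R 2) D2)).
    rewrite -!expectZ -expectD expect_cat; apply: le_expect => // l1.
    rewrite -!expectZ -expectD; apply: le_expect => // l2.
    rewrite /hit; case: eqP => [<-|_]; last by rewrite !mulr0 addr0.
    rewrite !mulr1 muE sumb big_cat /=.
    have := sqr_ge0 (dev s1 l1 - dev s2 l2).
    rewrite /dev; move: (\sum_(_ <- l1) _) (\sum_(_ <- l2) _) => u v; nra.
  have : beta * (size s1 + size s2)%:R <= beta * V by apply: ler_wpM2l.
  have : 0 <= beta * (size s1 + size s2)%:R by rewrite mulr_ge0.
  rewrite natrD; lra.
rewrite ler_pdivlMr; last by have := sqr_ge0 (x%:~R - mu); have : 0 < V^-1 by [rewrite invr_gt0]; nra.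
rewrite mulrDr mulr1 mulrCA mulrA.
have : (x%:~R - mu) ^+ 2 * point p a (s1 ++ s2) x / V <= beta by rewrite ler_pdivrMr.
lra.
Qed.
End PointBounds.

(** * Splitting sets evenly, and sums over separated means *)

Lemma sum_indicator (R : pzSemiRingType) (T : finType) (l : seq T) (S : {set T}) :
  uniq l -> \sum_(w <- l) (w \in S)%:R = #|S :&: [set w in l]|%:R :> R.
Proof.
move=> ul; rewrite -natr_sum; congr (_%:R).
have -> : (\sum_(w <- l) (w \in S) = count (mem S) l)%N.
  rewrite -sum1_count [RHS]big_mkcond; apply: eq_bigr => w _.
  by rewrite -[mem S w]/(w \in S); case: (w \in S).
rewrite -size_filter -(card_uniqP (filter_uniq _ ul)); apply: eq_card => w.
by rewrite mem_filter !inE.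
Qed.

(** A uniformly random subset of [X] works: by Chebyshev it meets a given set of
    size n in fewer than n/4 or more than 3n/4 elements with probability at
    most 4/n. *)
Lemma halving (T I : finType) (Q : {set I}) (S : I -> {set T}) (X : {set T}) (h : nat) :
  (0 < h)%N -> {in Q, forall i, h <= #|S i :&: X|}%N ->
  exists2 Y : {set T}, Y \subset X &
    (#|[set i in Q | (4 * #|S i :&: Y| < h) || (4 * #|S i :&: (X :\: Y)| < h)]| * h
     <= 4 * #|Q|)%N.
Proof.
move=> h0 hS.
(* probabilities take values in an arbitrary ordered field *)
have [R _] : exists R : realFieldType, True by exists rat.
pose p := fun _ : T => 2^-1 : R.
pose n i : R := #|S i :&: X|%:R.
pose a i w : R := (w \in S i)%:R.
have n0 i : i \in Q -> 0 < n i by move=> /hS hi; rewrite ltr0n; apply: leq_trans hi.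
have nE i : \sum_(w <- enum X) a i w = n i.
  rewrite sum_indicator ?enum_uniq //; congr (#|_ :&: _|%:R).
  by apply/setP => w; rewrite inE mem_enum.
have meanE i : mean p (a i) (enum X) = n i / 2.
  by rewrite /mean -mulr_suml nE.
pose F l := \sum_(i in Q) 16 / n i ^+ 2 * (\sum_(w <- l) a i w - n i / 2) ^+ 2.
have pp : probs p (enum X) by move=> w _; rewrite /p; lra.
have EF : expect p (enum X) F <= 4 * #|Q|%:R / h%:R.
  rewrite expect_sum [leRHS](_ : _ = \sum_(i in Q) 4 / h%:R); last first.
    by rewrite sumr_const -mulr_natr; ring.
  apply: ler_sum => i iQ; rewrite expectZ -meanE expect_var.
  have -> : \sum_(w <- enum X) a i w ^+ 2 * (p w * (1 - p w)) = n i / 4.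
    rewrite -nE mulr_suml; apply: eq_bigr => w _.
    by rewrite /a /p; case: (w \in S i); rewrite ?expr1n ?expr0n /=; field.
  have -> : 16 / n i ^+ 2 * (n i / 4) = 4 / n i.
    by field; rewrite lt0r_neq0 ?n0.
  have hn : h%:R <= n i by rewrite ler_nat; apply: hS.
  have hh : 0 < h%:R :> R by rewrite ltr0n.
  by rewrite ler_pM2l ?lef_pV2 ?posrE ?n0.
have [l sl Fl] := expect_exists F pp.
have ul : uniq l := subseq_uniq sl (enum_uniq X).
have sY : [set w in l] \subset X.
  by apply/subsetP => w; rewrite inE => /(mem_subseq sl); rewrite mem_enum.
exists [set w in l] => //; set Y := [set w in l] in sY *; set Bad := [set i in Q | _].
have {}Fl := le_trans Fl EF.
have hB : #|Bad|%:R <= F l.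
  rewrite /F (big_setID Bad) /= -[leLHS]addr0; apply: lerD; last first.
    apply: sumr_ge0 => i; rewrite inE => /andP[_ iQ].
    by rewrite mulr_ge0 ?sqr_ge0 // divr_ge0 ?sqr_ge0.
  rewrite (setIidPr _); last by apply/subsetP => i; rewrite inE => /andP[].
  rewrite -sumr_const; apply: ler_sum => i; rewrite inE => /andP[iQ hi].
  rewrite sum_indicator // -/Y.
  have cX : (#|S i :&: X| = #|S i :&: Y| + #|S i :&: (X :\: Y)|)%N.
    rewrite -(cardsID Y (S i :&: X)) -setIA (setIidPr sY); congr (_ + #|_|)%N.
    by rewrite setIDA.
  have {}hi : 4 * #|S i :&: Y|%:R <= n i \/ 3 * n i <= 4 * #|S i :&: Y|%:R.
    have hSi := hS _ iQ; rewrite /n cX -!natrM !ler_nat.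
    by case/orP: hi => hi; [left|right]; lia.
  rewrite mulrAC ler_pdivlMr ?exprn_gt0 ?n0 // mul1r.
  have := n0 _ iQ; move: (n i) (#|S i :&: Y|%:R : R) hi => m y [hy|hy] m0; nra.
have : #|Bad|%:R * h%:R <= 4 * #|Q|%:R :> R.
  by rewrite -ler_pdivlMr ?ltr0n //; apply: le_trans Fl.
by rewrite -!natrM ler_nat.
Qed.

(** Compare with the telescoping series 3/((d+1)(d+2)) on both sides of [a]. *)
Lemma sum_inverse_quadratic (R : realFieldType) (M a : nat) :
  \sum_(0 <= j < M) (1 + ((j%:R - a%:R) : R) ^+ 2)^-1 <= 6.
Proof.
pose f d : R := 3 / ((d%:R + 1) * (d%:R + 2)).
have hf (x : R) d : x ^+ 2 = d%:R ^+ 2 -> (1 + x ^+ 2)^-1 <= f d.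
  move=> ->.
  have h : (d%:R + 1) * (d%:R + 2) <= 3 * (1 + d%:R ^+ 2) :> R.
    rewrite -natrX natr1 nat1r -natrD -!natrM ler_nat; case: d => [|[|d]] //.
    by rewrite !expnS expn0; clear; nia.
  have d0 : 0 <= d%:R :> R by [].
  rewrite /f ler_pdivlMr; last by rewrite mulr_gt0 // ltr_wpDl.
  by rewrite mulrC ler_pdivrMr // ltr_pwDl // sqr_ge0.
(* a telescoping majorant of the partial sums; the two branches are the two
   sides of [a] *)
pose Psi n : R := if (n <= a.+1)%N then 3 / (a.+2 - n)%:R else 6 - 3 / (n - a).+1%:R.
have Psi6 n : Psi n <= 6.
  rewrite /Psi; case: ifP => hn.
    rewrite ler_pdivrMr ?ltr0n ?subn_gt0 //; have : 1 <= (a.+2 - n)%:R :> R by rewrite ler1n subn_gt0.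
    lra.
  by rewrite gerBl divr_ge0.
apply: le_trans (Psi6 M); elim: M => [|M IH].
  by rewrite big_geq // /Psi /= divr_ge0.
rewrite big_nat_recr //=; apply: le_trans (lerD IH (lexx _)) _; rewrite /Psi.
have [Ma|aM] := leqP M a.
  rewrite ltnS Ma (leq_trans Ma) //.
  have [d ->] : exists d, a = (M + d)%N by exists (a - M)%N; rewrite subnKC.
  rewrite (_ : (M + d).+2 - M = d.+2)%N; last by lia.
  rewrite (_ : (M + d).+2 - M.+1 = d.+1)%N; last by lia.
  have hd : (M%:R - (M + d)%:R) ^+ 2 = d%:R ^+ 2 :> R by rewrite natrD; ring.
  apply: le_trans (lerD (lexx _) (hf _ _ hd)) _; rewrite /f.
  have d0 : 0 <= d%:R :> R by [].
  rewrite -!natr1; apply: le_of_eq; field.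
  by rewrite !lt0r_neq0 //; lra.
have [d Md] : exists d, M = (a.+1 + d)%N by exists (M - a.+1)%N; rewrite subnKC.
have hd : (M%:R - a%:R) ^+ 2 = d.+1%:R ^+ 2 :> R.
  by rewrite Md natrD -!natr1; ring.
apply: le_trans (lerD (lexx _) (hf _ _ hd)) _; rewrite /f.
rewrite Md (_ : ((a.+1 + d).+1 <= a.+1)%N = false); last by lia.
have d0 : 0 <= d%:R :> R by [].
rewrite (_ : (a.+1 + d).+1 - a = d.+2)%N; last by lia.
case: d Md hd d0 => [|d] Md hd d0.
  rewrite addn0 leqnn (_ : a.+2 - a.+1 = 1)%N; last by lia.
  by rewrite -subr_ge0 [leRHS](_ : _ = 3 / 2); [lra|field].
rewrite ifN; last by lia.
rewrite (_ : a.+1 + d.+1 - a = d.+2)%N; last by lia.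
rewrite -!natr1; apply: le_of_eq; field.
by rewrite -!natr1 in d0; rewrite !lt0r_neq0 //; lra.
Qed.

(** The means that are farther than the nearest one from [y] are at least half
    as far from [y] as from the nearest one. *)
Lemma sum_separated (R : realFieldType) (M : nat) (J : pred 'I_M) (mu : 'I_M -> R)
    (y rho V k : R) :
  0 < V -> 0 < k -> k <= 1 -> 0 <= rho -> 4 * V * k <= rho ^+ 2 ->
  (forall i j : 'I_M, J i -> J j -> (i <= j)%N ->
     (j%:R - i%:R) * rho <= mu j - mu i) ->
  \sum_(j | J j) (1 + (y - mu j) ^+ 2 / V)^-1 <= 6 / k.
Proof.
move=> V0 k0 k1 rho0 hV sep.
have [j1 Jj1|J0] := pickP J; last first.
  by rewrite big_pred0 // divr_ge0 // ltW.
case: (Order.TotalTheory.arg_minP (fun j => `|y - mu j|) Jj1) => j0 Jj0 minj0.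
apply: (@le_trans _ _ (\sum_(j < M) k^-1 * (1 + (j%:R - j0%:R) ^+ 2)^-1)); last first.
  rewrite -big_distrr /= mulrC ler_pM2r ?invr_gt0 //.
  rewrite -(big_mkord xpredT (fun j => (1 + (j%:R - j0%:R) ^+ 2)^-1)).
  exact: sum_inverse_quadratic.
rewrite big_mkcond; apply: ler_sum => j _; case: ifP => Jj; last first.
  by rewrite mulr_ge0 // invr_ge0 ?addr_ge0 ?sqr_ge0 // ltW.
have h1 : ((j%:R - j0%:R) * rho) ^+ 2 <= (mu j - mu j0) ^+ 2.
  have [le|le] := leqP j0 j.
    have := sep _ _ Jj0 Jj le; have : 0 <= (j%:R - j0%:R) * rho.
      by rewrite mulr_ge0 // subr_ge0 ler_nat.
    by move=> h0 h; rewrite lerXn2r // nnegrE; apply: le_trans h.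
  have := sep _ _ Jj Jj0 (ltnW le); have : 0 <= (j0%:R - j%:R) * rho.
    by rewrite mulr_ge0 // subr_ge0 ler_nat ltnW.
  move=> h0 h; rewrite -sqrrN -[leRHS]sqrrN -mulNr !opprB.
  by rewrite lerXn2r // nnegrE; apply: le_trans h.
have h2 : (mu j - mu j0) ^+ 2 <= 4 * (y - mu j) ^+ 2.
  have : (y - mu j0) ^+ 2 <= (y - mu j) ^+ 2.
    have := minj0 _ Jj; rewrite -[X in _ -> _ <= X]real_normK ?num_real //.
    by rewrite -[X in _ -> X <= _]real_normK ?num_real // => h; rewrite lerXn2r ?nnegrE.
  have := sqr_ge0 ((y - mu j) + (y - mu j0)).
  by move: (mu j) (mu j0) => a b; nra.
have h3 : k * (j%:R - j0%:R) ^+ 2 <= (y - mu j) ^+ 2 / V.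
  rewrite ler_pdivlMr //.
  have : (j%:R - j0%:R) ^+ 2 * (4 * V * k) <= 4 * (y - mu j) ^+ 2.
    apply: le_trans (le_trans h1 h2); rewrite exprMn; apply: ler_wpM2l => //.
    exact: sqr_ge0.
  by move: ((j%:R - j0%:R) ^+ 2) ((y - mu j) ^+ 2) => a b; lra.
have d0 := sqr_ge0 (j%:R - j0%:R : R).
rewrite -invfM lef_pV2 ?posrE.
- by rewrite mulrDr mulr1; apply: lerD.
- by apply: ltr_pwDl => //; apply: divr_ge0; [exact: sqr_ge0|exact: ltW].
- by rewrite mulr_gt0 // ltr_pwDl.
Qed.

Section Resample.
Variables (R : realFieldType) (T A : finType).
Implicit Type z : {ffun T -> A}.

Definition update z (u : T) (x : A) : {ffun T -> A} :=
  [ffun w => if w == u then x else z w].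

(** Drawing one coordinate afresh preserves the uniform distribution:
    exchanging the old and the new value is an involution. *)
Lemma sum_resample (u : T) (f : {ffun T -> A} -> R) :
  \sum_z \sum_x f (update z u x) = #|A|%:R * \sum_z f z.
Proof.
pose swap (q : {ffun T -> A} * A) := (update q.1 u q.2, q.1 u).
have swapK : involutive swap.
  move=> [z x]; rewrite /swap /=; congr (_, _); last by rewrite ffunE eqxx.
  by apply/ffunP => w; rewrite !ffunE; case: eqP => [->|].
rewrite pair_bigA /= (reindex_inj (inv_inj swapK)) /=.
have E q : update (update q.1 u q.2) u (q.1 u) = q.1 := congr1 fst (swapK q).
under eq_bigr => q _ do rewrite E.
rewrite -(pair_bigA _ (fun z _ => f z)) /= exchange_big /=.
by rewrite sumr_const mulr_natl.
Qed.

Lemma sum_sqr_independent (y : A -> R) (B : {set T}) (V : R) :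
  \sum_x y x = 0 -> (forall x, y x ^+ 2 <= V) ->
  \sum_(z : {ffun T -> A}) (\sum_(a in B) y (z a)) ^+ 2 <= #|{ffun T -> A}|%:R * (#|B|%:R * V).
Proof.
move=> y0 yV.
have cross a b : a != b -> \sum_(z : {ffun T -> A}) y (z a) * y (z b) = 0.
  move=> ab; have [A0|A0] := posnP #|A|.
    apply: big1 => z _; have := fintype0 (z a); by rewrite A0 => /(_ (erefl _)).
  have : #|A|%:R * \sum_(z : {ffun T -> A}) y (z a) * y (z b) = 0.
    rewrite -(sum_resample a); apply: big1 => z _.
    under eq_bigr => x _ do rewrite !ffunE eqxx eq_sym (negbTE ab).
    by rewrite -mulr_suml y0 mul0r.
  by move/eqP; rewrite mulf_eq0 pnatr_eq0 eqn0Ngt A0 => /eqP.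
have E (z : {ffun T -> A}) : (\sum_(a in B) y (z a)) ^+ 2 =
    \sum_(a in B) \sum_(b in B) y (z a) * y (z b).
  by rewrite expr2 mulr_suml; apply: eq_bigr => a _; rewrite mulr_sumr.
under eq_bigr do rewrite E.
rewrite exchange_big /= mulrCA mulr_natl -sumr_const; apply: ler_sum => a aB.
rewrite exchange_big /= (bigD1 a) //= [X in _ + X]big1 ?addr0; last first.
  by move=> b /andP[_ ba]; apply: cross; rewrite eq_sym.
rewrite mulr_natl -sumr_const; apply: ler_sum => z _.
by rewrite -expr2.
Qed.
End Resample.

(** * Tilted random subsets *)

Definition clamp (R : realFieldType) (x : R) : R := Num.max 0 (Num.min 1 x).

Lemma clamp01 (R : realFieldType) (x : R) : 0 <= clamp x <= 1.
Proof. by rewrite /clamp le_max lexx ge_max ler01 ge_min lexx. Qed.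

Lemma le_clamp (R : realFieldType) (x y : R) : x <= y -> clamp x <= clamp y.
Proof.
move=> xy; rewrite /clamp ge_max !le_max lexx /=; apply/orP; right.
by rewrite le_min !ge_min lexx xy orbT.
Qed.

Lemma clamp_id (R : realFieldType) (x : R) : 0 <= x <= 1 -> clamp x = x.
Proof. by move=> /andP[x0 x1]; rewrite /clamp min_r // max_r. Qed.

Definition diff_nbr (T : finType) (e : rel T) (u v w : T) : int :=
  (e u w)%:Z - (e v w)%:Z.

Lemma diff_nbr_norm (T : finType) (e : rel T) u v w : `|diff_nbr e u v w| <= 1.
Proof. by rewrite /diff_nbr; case: (e u w); case: (e v w). Qed.

Lemma diff_nbr_neq0 (T : finType) (e : rel T) u v w :
  (diff_nbr e u v w != 0) = (e u w != e v w).
Proof. by rewrite /diff_nbr; case: (e u w); case: (e v w). Qed.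

Section Tilt.
Variables (R : realFieldType) (T : finType) (e : rel T) (U D : {set T}).
Variables (r : nat) (scale : R).
Hypothesis scale0 : 0 < scale.
Implicit Types (z : {ffun T -> 'I_r}) (u v w : T).

Definition centred (j : 'I_r) : R := j%:R - (r%:R - 1) / 2.

Definition tilt z w : R := \sum_(a in U :&: [set a | e a w]) centred (z a).

Definition tprob z w : R :=
  if w \in D then clamp (2^-1 + tilt z w / scale) else 2^-1.

(** Outside this set the argument of [clamp] in [tprob] lies in [0,1]. *)
Definition clipped z : {set T} := [set w in D | scale / 2 < `|tilt z w|].

Lemma sum_centred : \sum_j centred j = 0.
Proof.
rewrite sumrB sumr_const card_ord.
have : \sum_(j < r) (j%:R : R) = r%:R * (r%:R - 1) / 2.
  rewrite -(big_mkord xpredT (fun j => j%:R : R)).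
  elim: r => [|n IH]; first by rewrite big_geq // !mul0r.
  by rewrite big_nat_recr //= IH -natr1; field.
by move=> ->; rewrite -mulr_natl; field.
Qed.

Lemma centred_sqr j : centred j ^+ 2 <= r%:R ^+ 2 / 4.
Proof.
have h0 : 0 <= j%:R :> R by [].
have h1 : j%:R + 1 <= r%:R :> R by rewrite natr1 ler_nat ltn_ord.
rewrite /centred; nra.
Qed.

Lemma tprob01 z w : 0 <= tprob z w <= 1.
Proof. by rewrite /tprob; case: ifP => _; [exact: clamp01 | lra]. Qed.

Lemma tprob_unclipped z w : w \in D -> w \notin clipped z ->
  tprob z w = 2^-1 + tilt z w / scale.
Proof.
move=> wD; rewrite inE wD /= -leNgt ler_norml => /andP[h1 h2].
rewrite /tprob wD clamp_id //; apply/andP; split.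
  have : - (1/2) <= tilt z w / scale by rewrite ler_pdivlMr //; lra.
  lra.
have : tilt z w / scale <= 1/2 by rewrite ler_pdivrMr //; lra.
lra.
Qed.

Lemma tilt_update z u i j w : u \in U ->
  tilt (update z u j) w = tilt (update z u i) w + (e u w)%:R * (j%:R - i%:R).
Proof.
move=> uU; rewrite /tilt.
have rest x : \sum_(a in U :&: [set a | e a w] | a != u) centred (update z u x a) =
    \sum_(a in U :&: [set a | e a w] | a != u) centred (z a).
  by apply: eq_bigr => a /andP[_ /negbTE au]; rewrite ffunE au.
have [uw|/negbTE uw] := boolP (e u w).
  have uS : u \in U :&: [set a | e a w] by rewrite !inE uU.
  rewrite !(bigD1 u uS) /= !rest !ffunE eqxx /centred; ring.
rewrite mul0r addr0; apply: eq_bigr => a; rewrite !inE => /andP[_ aw].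
by rewrite !ffunE; case: eqP aw => // ->; rewrite uw.
Qed.

(** Chebyshev: the tilt of a vertex is a sum of at most [#|U|] independent
    centred terms of size at most r/2. *)
Lemma sum_clipped :
  \sum_z #|clipped z|%:R * scale ^+ 2 <=
  #|{ffun T -> 'I_r}|%:R * (#|T|%:R * (#|U|%:R * r%:R ^+ 2)) :> R.
Proof.
have sqr_gt (y : R) : scale / 2 < y -> scale ^+ 2 <= 4 * y ^+ 2.
  move=> h; have : 0 <= (y - scale / 2) * (y + scale / 2) by have s0 := scale0; apply: mulr_ge0; lra.
  lra.
apply: (@le_trans _ _ (\sum_z \sum_(w : T) 4 * tilt z w ^+ 2)).
  apply: ler_sum => z _; rewrite mulr_natl -sumr_const.
  rewrite big_mkcond; apply: ler_sum => w _; case: ifP; last first.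
    by move=> _; rewrite mulr_ge0 // sqr_ge0.
  rewrite inE => /andP[_ h]; rewrite -(real_normK (num_real (tilt z w))).
  exact: sqr_gt.
rewrite exchange_big /= mulrCA.
have sum_T (x : R) : #|T|%:R * x = \sum_(w : T) x by rewrite sumr_const mulr_natl.
rewrite sum_T; apply: ler_sum => w _; rewrite -mulr_sumr.
pose Z : R := #|{ffun T -> 'I_r}|%:R; rewrite -/Z.
have h : \sum_z tilt z w ^+ 2 <=
    Z * (#|U :&: [set a | e a w]|%:R * (r%:R ^+ 2 / 4)).
  exact: (sum_sqr_independent _ sum_centred centred_sqr).
apply: (@le_trans _ _ (4 * (Z * (#|U :&: [set a | e a w]|%:R * (r%:R ^+ 2 / 4))))).
  by rewrite ler_pM2l.
have -> (n : R) : 4 * (Z * (n * (r%:R ^+ 2 / 4))) = Z * (n * r%:R ^+ 2) by field.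
apply: ler_wpM2l => //; apply: ler_wpM2r; first exact: sqr_ge0.
by rewrite ler_nat subset_leq_card // subsetIl.
Qed.

(** Raising the tilt of [u] affects only the neighbours of [u] and raises their
    probabilities.  Those also joined to [v] cancel in the difference; each
    unclipped neighbour of [u] outside N(v) contributes (j - i) / scale, and the
    clipped ones never contribute negatively. *)
Lemma mean_update z u v (i j : 'I_r) (g : nat) (s1 s2 : seq T) :
  u \in U -> v \in U -> u != v -> (i <= j)%N ->
  (2 * g <= #|[set w in D | e u w && ~~ e v w]|)%N ->
  (2 * #|clipped (update z u i)| <= g)%N -> (2 * #|clipped (update z u j)| <= g)%N ->
  (j%:R - i%:R) * (g%:R / scale) <=
    mean (tprob (update z u j)) (fun w => (diff_nbr e u v w)%:~R) (s1 ++ enum D ++ s2) -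
    mean (tprob (update z u i)) (fun w => (diff_nbr e u v w)%:~R) (s1 ++ enum D ++ s2).
Proof.
move=> uU vU uv ij hg ci cj.
pose b w : R := (diff_nbr e u v w)%:~R.
pose d w := b w * (tprob (update z u j) w - tprob (update z u i) w).
have ji : 0 <= j%:R - i%:R :> R by rewrite subr_ge0 ler_nat.
have d0 w : 0 <= d w.
  rewrite /d /b /diff_nbr; have [uw|/negbTE uw] := boolP (e u w); last first.
    by rewrite /tprob (tilt_update z i j w uU) uw mul0r addr0 subrr mulr0.
  case: (e v w); first by rewrite subrr mul0r.
  rewrite subr0 mul1r subr_ge0 /tprob; case: ifP => // _; apply: le_clamp.
  rewrite (tilt_update z i j w uU) uw mul1r lerD2l ler_pM2r ?invr_gt0 //.
  by rewrite lerDl.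
have -> : mean (tprob (update z u j)) b (s1 ++ enum D ++ s2) -
    mean (tprob (update z u i)) b (s1 ++ enum D ++ s2) = \sum_(w <- s1 ++ enum D ++ s2) d w.
  by rewrite /mean -sumrB; apply: eq_bigr => w _; rewrite /d mulrBr.
rewrite !big_cat /= big_enum /=.
have s0 s : 0 <= \sum_(w <- s) d w by exact: sumr_ge0.
apply: (@le_trans _ _ (\sum_(w in D) d w)); last by rewrite addrCA lerDl addr_ge0.
(* at least 2g - g/2 - g/2 vertices are unclipped at both values *)
pose W := [set w in D | e u w && ~~ e v w] :\: (clipped (update z u i) :|: clipped (update z u j)).
have cW : (g <= #|W|)%N.
  have h1 := cardsID (clipped (update z u i) :|: clipped (update z u j)) [set w in D | e u w && ~~ e v w].
  have h2 := (leq_card_setU (clipped (update z u i)) (clipped (update z u j))).1.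
  have h3 : (#|[set w in D | e u w && ~~ e v w] :&: (clipped (update z u i) :|: clipped (update z u j))|
     <= #|clipped (update z u i) :|: clipped (update z u j)|)%N.
    by apply: subset_leq_card; apply: subsetIr.
  rewrite -/W in h1; move: h1 h2 h3 hg ci cj; clear; lia.
apply: (@le_trans _ _ (\sum_(w in W) (j%:R - i%:R) / scale)).
  rewrite sumr_const -[leRHS]mulr_natr mulrA mulrAC.
  by apply: ler_wpM2l; rewrite ?ler_nat // divr_ge0 // ltW.
rewrite big_mkcond [leRHS]big_mkcond; apply: ler_sum => w _.
case: ifP => [|_]; last by case: ifP.
rewrite in_setD in_setU negb_or => /andP[/andP[ni nj]].
rewrite inE => /andP[wD /andP[uw vw]].
rewrite wD /d /b /diff_nbr uw (negbTE vw) subr0 mul1r.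
rewrite !tprob_unclipped // (tilt_update z i j w uU) uw mul1r.
by apply: le_of_eq; field; rewrite lt0r_neq0.
Qed.
End Tilt.

Section PairBound.
Variables (R : realFieldType) (T : finType) (e : rel T) (U D : {set T}).
Variables (r g : nat) (scale beta V k : R) (s1 s2 : seq T).
Hypotheses (scale0 : 0 < scale) (beta0 : 0 <= beta)
  (V0 : 0 < V) (k0 : 0 < k) (k1 : k <= 1).
Hypothesis hbeta : 1 <= beta ^+ 2 * g%:R.
Hypothesis hk : 4 * V * k <= (g%:R / scale) ^+ 2.
Hypothesis hV : (size s1 + size (enum D ++ s2))%:R <= V.
Hypotheses (s1D : {in s1, forall w, w \notin D}) (s2D : {in s2, forall w, w \notin D}).

Let s := s1 ++ enum D ++ s2.
Let p z := @tprob R T e U D r scale z.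

Definition unclipped (z : {ffun T -> 'I_r}) : bool :=
  (2 * #|clipped e U D scale z| <= g)%N.

Lemma diff_nbr_opp u v w : diff_nbr e v u w = - diff_nbr e u v w.
Proof. by rewrite /diff_nbr opprB. Qed.

Lemma point_diff_nbr_sym q u v (l : seq T) x :
  point q (diff_nbr e u v) l x = point q (diff_nbr e v u) l (- x) :> R.
Proof.
apply: eq_expect => l'; under [in RHS]eq_bigr do rewrite diff_nbr_opp.
by rewrite sumrN eqr_opp.
Qed.

(** Average over the tilt of [u] first.  For fixed other tilts, the means at
    those values of this tilt that clip few vertices are separated, so the
    quadratic point bounds add up to a constant times [beta] instead of r times
    [beta]. *)
Lemma oriented_pair_bound u v x :
  u \in U -> v \in U -> u != v ->
  (2 * g <= #|[set w in D | e u w && ~~ e v w]|)%N ->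
  (g <= count (fun w => e u w != e v w) s1)%N ->
  (g <= count (fun w => e u w != e v w) s2)%N ->
  r%:R * (\sum_(z | unclipped z) point (p z) (diff_nbr e u v) s x) <=
    #|{ffun T -> 'I_r}|%:R * (2 * beta * (6 / k)).
Proof.
move=> uU vU uv hD h1 h2.
have [r0|r0] := posnP r.
  have -> : r%:R = 0 :> R by rewrite r0.
  rewrite mul0r mulr_ge0 //; apply: mulr_ge0; first exact: mulr_ge0.
  by apply: divr_ge0 => //; exact: ltW.
pose mu z := mean (p z) (fun w => (diff_nbr e u v w)%:~R) s.
have fair z l : {in l, forall w, w \notin D} ->
    (g <= count (fun w => e u w != e v w) l)%N ->
    forall y, point (p z) (diff_nbr e u v) l y <= beta.
  move=> lD hl y; apply: fair_point_le => //.
  - by move=> w /lD /negbTE wD; rewrite /p /tprob wD.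
  - by move=> w _; apply: diff_nbr_norm.
  apply: (le_trans hbeta); apply: ler_wpM2l; first exact: sqr_ge0.
  rewrite ler_nat leqW // (eq_count (a2 := fun w => e u w != e v w)) //.
  exact: diff_nbr_neq0.
have pz z l : probs (p z) l by move=> w _; apply: tprob01.
have bound z : point (p z) (diff_nbr e u v) s x <=
    2 * beta * (1 + (x%:~R - mu z) ^+ 2 / V)^-1.
  apply: point_le_quadratic => //.
  - by move=> w _; apply: diff_nbr_norm.
  - exact: fair.
  - by move=> y; apply: point_cat_le => //; apply: fair.
have -> : r%:R = #|'I_r|%:R :> R by rewrite card_ord.
rewrite big_mkcond -(sum_resample u).
rewrite mulr_natl -sumr_const; apply: ler_sum => z _.
rewrite -big_mkcond /=.
apply: (@le_trans _ _ (\sum_(j | unclipped (update z u j))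
   2 * beta * (1 + (x%:~R - mu (update z u j)) ^+ 2 / V)^-1)).
  exact: ler_sum.
rewrite -mulr_sumr; apply: ler_wpM2l; first by rewrite mulr_ge0.
apply: (@sum_separated R r _ _ _ (g%:R / scale)) => //.
  by rewrite divr_ge0 // ltW.
move=> i j ci cj ij.
exact: (mean_update scale0 s1 s2 uU vU uv ij hD ci cj).
Qed.

(** One of N(u) minus N(v) and N(v) minus N(u) has half of the symmetric
    difference on [D]; the roles of [u] and [v] are interchanged accordingly. *)
Lemma pair_bound u v x :
  u \in U -> v \in U -> u != v ->
  (4 * g <= #|[set w | e u w != e v w] :&: D|)%N ->
  (g <= count (fun w => e u w != e v w) s1)%N ->
  (g <= count (fun w => e u w != e v w) s2)%N ->
  r%:R * (\sum_(z | unclipped z) point (p z) (diff_nbr e u v) s x) <=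
    #|{ffun T -> 'I_r}|%:R * (2 * beta * (6 / k)).
Proof.
move=> uU vU uv hD h1 h2.
have cD : (#|[set w | e u w != e v w] :&: D| <=
    #|[set w in D | e u w && ~~ e v w]| + #|[set w in D | e v w && ~~ e u w]|)%N.
  apply: leq_trans (leq_card_setU _ _).1; apply: subset_leq_card.
  apply/subsetP => w; rewrite !inE => /andP[+ ->] /=.
  by case: (e u w); case: (e v w).
have [h|h] := leqP (2 * g) #|[set w in D | e u w && ~~ e v w]|.
  exact: oriented_pair_bound.
under eq_bigr do rewrite point_diff_nbr_sym.
apply: oriented_pair_bound => //; rewrite 1?eq_sym //.
- by move: hD cD h; clear; lia.
- by rewrite (eq_count (a2 := fun w => e u w != e v w)) // => w; rewrite eq_sym.
- by rewrite (eq_count (a2 := fun w => e u w != e v w)) // => w; rewrite eq_sym.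
Qed.
End PairBound.

(** * From few collisions to many degrees *)

Lemma sqr_sum_le (A : Type) (S : seq A) (n : A -> nat) :
  ((\sum_(d <- S) n d) ^ 2 <= size S * \sum_(d <- S) n d ^ 2)%N.
Proof.
elim: S => [|d S IH]; first by rewrite !big_nil.
rewrite !big_cons /=; case: S IH => [|d' S] IH; first by rewrite !big_nil !addn0 mul1n.
move: IH; rewrite [size _]/=; move: (\sum_(_ <- _) _)%N (\sum_(_ <- _) _)%N => q a.
move: (size S).+1 (ltn0Sn (size S)) (n d) => j j0 b h.
have h2 : (2 * (b * a) <= j * b ^ 2 + q)%N.
  rewrite -(leq_pmul2l j0).
  have -> : (j * (2 * (b * a)) = 2 * (j * b * a))%N by ring.
  have -> : (j * (j * b ^ 2 + q) = (j * b) ^ 2 + j * q)%N by ring.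
  by apply: leq_trans (nat_Cauchy _ _) _; rewrite leq_add2l.
rewrite sqrnD mulSn mulnDr.
apply: (@leq_trans (b ^ 2 + j * q + (j * b ^ 2 + q))); last by apply: eq_leq; ring.
by apply: leq_add; rewrite // leq_add2l.
Qed.

(** Cauchy-Schwarz for the fibres of [f]. *)
Lemma card_sqr_collisions (T : finType) (f : T -> nat) (U : {set T}) :
  (#|U| ^ 2 <= size (undup [seq f v | v in U]) *
     #|[set q : T * T | [&& q.1 \in U, q.2 \in U & f q.1 == f q.2]]|)%N.
Proof.
set S := undup _; pose n d := #|[set v in U | f v == d]|.
have inS v : v \in U -> f v \in S.
  by move=> vU; rewrite mem_undup; apply/imageP; exists v.
have fibre (F : T -> nat) :
    (\sum_(v in U) F v = \sum_(d <- S) \sum_(v in U | f v == d) F v)%N.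
  rewrite (exchange_big_dep (mem U)) //=; last by move=> d v _ /andP[].
  apply: eq_bigr => v vU; rewrite (big_rem (f v)) ?inS //= vU eqxx /=.
  rewrite big1_seq ?addn0 // => d /andP[/eqP <-].
  by rewrite mem_rem_uniqF ?undup_uniq.
have nE d : (\sum_(v in U | f v == d) 1 = n d)%N.
  by rewrite sum1_card; apply: eq_card => v; rewrite !inE.
have cU : #|U| = (\sum_(d <- S) n d)%N.
  by rewrite -sum1_card fibre; apply: eq_bigr => d _.
have cP : #|[set q : T * T | [&& q.1 \in U, q.2 \in U & f q.1 == f q.2]]| =
    (\sum_(d <- S) n d ^ 2)%N.
  rewrite -sum1_card (eq_bigl (fun q => (q.1 \in U) && ((q.2 \in U) && (f q.2 == f q.1)))); last first.
    by move=> q; rewrite inE [f q.1 == _]eq_sym.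
  rewrite -(pair_big_dep (mem U) (fun u v => (v \in U) && (f v == f u)) (fun _ _ => 1%N)) /=.
  rewrite fibre; apply: eq_bigr => d _.
  rewrite (eq_bigr (fun _ => n d)) => [|v /andP[_ /eqP ->]]; last exact: nE.
  by rewrite -[X in (n d ^ X)%N]/2%N expnS expn1 -{2}nE big_distrl /=; under eq_bigr do rewrite -[n d]mul1n.
rewrite cU cP.
exact: sqr_sum_le.
Qed.

(** First some tilts with few clipped vertices, then an outcome of the coins, with no
    more than the average number of collisions.  As at least half of all tilts have few
    clipped vertices, restricting to them costs a factor 2. *)
Lemma exists_few_collisions (R : realFieldType) (T : finType) (e : rel T) (U D : {set T})
    (r g : nat) (scale beta k : R) (s1 s2 : seq T) (GP : {set T * T}) (x : T -> T -> int) :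
  let s := s1 ++ enum D ++ s2 in
  (0 < r)%N -> 0 <= 2 * beta * (6 / k) ->
  (#|{ffun T -> 'I_r}| <= 2 * #|[set z | @unclipped R T e U D r g scale z]|)%N ->
  (forall u v, (u, v) \in GP ->
    r%:R * (\sum_(z | unclipped e U D g scale z)
        point (@tprob R T e U D r scale z) (diff_nbr e u v) s (x u v)) <=
    #|{ffun T -> 'I_r}|%:R * (2 * beta * (6 / k))) ->
  exists2 l, subseq l s &
    #|[set q in GP | \sum_(w <- l) diff_nbr e q.1 q.2 w == x q.1 q.2]|%:R * r%:R
      <= 2 * (#|GP|%:R * (2 * beta * (6 / k))).
Proof.
set B := 2 * beta * (6 / k) => s r0 B0 hZ hGP.
pose Z : R := #|{ffun T -> 'I_r}|%:R.
pose p z := @tprob R T e U D r scale z.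
pose tot z : R := \sum_(q in GP) point (p z) (diff_nbr e q.1 q.2) s (x q.1 q.2).
have Z0 : 0 < Z.
  by rewrite ltr0n card_ffun card_ord expn_gt0 r0.
have sumtot : r%:R * (\sum_(z | unclipped e U D g scale z) tot z) <= #|GP|%:R * (Z * B).
  rewrite exchange_big mulr_sumr /= mulr_natl -sumr_const.
  by apply: ler_sum => -[u v] uv; apply: hGP.
have [z zg hz] : exists2 z, unclipped e U D g scale z & r%:R * tot z <= 2 * (#|GP|%:R * B).
  have [/existsP[z /andP[? ?]]|/existsPn no] := boolP [exists z,
    unclipped e U D g scale z && (r%:R * tot z <= 2 * (#|GP|%:R * B))]; first by exists z.
  exfalso.
  have : \sum_(z : {ffun T -> 'I_r} | unclipped e U D g scale z) 2 * (#|GP|%:R * B) <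
         \sum_(z | unclipped e U D g scale z) r%:R * tot z.
    apply: ltr_sum => [|z zg].
      apply/hasP.
      have : (0 < #|[set z | @unclipped R T e U D r g scale z]|)%N.
        have : (0 < #|{ffun T -> 'I_r}|)%N by rewrite -(ltr0n R).
        by move: hZ; clear; lia.
      case/card_gt0P => z; rewrite inE => zg; exists z => //.
    by have := no z; rewrite zg /= -ltNge.
  apply/negP; rewrite -leNgt -mulr_sumr; apply: (le_trans sumtot).
  rewrite -[leRHS](_ : #|[set z | @unclipped R T e U D r g scale z]|%:R * (2 * (#|GP|%:R * B)) = _).
    apply: (@le_trans _ _ ((2 * #|[set z | @unclipped R T e U D r g scale z]|)%N%:R * (#|GP|%:R * B))).
      by rewrite mulrCA; apply: ler_wpM2r; [rewrite mulr_ge0|rewrite ler_nat].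
    by rewrite natrM; apply: le_of_eq; ring.
  by rewrite mulr_natl -sumr_const; apply: eq_bigl => z; rewrite inE.
have [l sl hl] := @expect_exists R T (p z) s (fun l => \sum_(q in GP)
    (\sum_(w <- l) diff_nbr e q.1 q.2 w == x q.1 q.2)%:R) (fun w _ => tprob01 _ _ _ _ _ _).
exists l => //; rewrite mulrC; apply: le_trans hz; apply: ler_wpM2l => //.
apply: le_trans (le_trans hl _); last by rewrite expect_sum.
rewrite -natr_sum ler_nat -sum1_card big_mkcond [leqRHS]big_mkcond /=.
by apply: leq_sum => q _; rewrite inE; case: (q \in GP) => //=; case: (_ == _).
Qed.

Lemma count_enum (T : finType) (P : pred T) (A : {set T}) :
  count P (enum A) = #|[set w | P w] :&: A|.
Proof.
rewrite -size_filter cardE; apply/perm_size/uniq_perm.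
- exact/filter_uniq/enum_uniq.
- exact: enum_uniq.
- by move=> w; rewrite mem_filter !mem_enum !inE.
Qed.

Lemma num_degrees_ge (T : finType) (e : rel T) (U W : {set T}) : U \subset W ->
  (size (undup [seq degree_in e W v | v in U]) <= num_degrees e W)%N.
Proof.
move=> /subsetP UW; apply: uniq_leq_size; first exact: undup_uniq.
move=> d; rewrite !mem_undup => /imageP[v vU ->].
by apply/imageP; exists v => //; apply: UW.
Qed.

Lemma degree_in_union (T : finType) (e : rel T) (U : {set T}) (l : seq T) v :
  uniq l -> {in l, forall w, w \notin U} ->
  degree_in e (U :|: [set w in l]) v = (degree_in e U v + count (e v) l)%N.
Proof.
move=> ul lU; rewrite /degree_in.
have -> : count (e v) l = #|[set w in l | e v w]|.
  rewrite -size_filter -(card_uniqP (filter_uniq _ ul)).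
  by apply: eq_card => w; rewrite !inE mem_filter andbC.
rewrite -(cardsID U [set w in U :|: _ | e v w]); congr addn; apply: eq_card => w.
  by rewrite !inE; case: (w \in U); rewrite ?andbF ?andbT.
rewrite !inE; case wU: (w \in U) => //=.
by case wl: (w \in l) => //; have := lU _ wl; rewrite wU.
Qed.

Lemma degree_eq_iff (T : finType) (e : rel T) (U : {set T}) (l : seq T) u v :
  uniq l -> {in l, forall w, w \notin U} ->
  (degree_in e (U :|: [set w in l]) u == degree_in e (U :|: [set w in l]) v) =
  (\sum_(w <- l) diff_nbr e u v w ==
     (degree_in e U v)%:Z - (degree_in e U u)%:Z).
Proof.
move=> ul lU; rewrite !degree_in_union //.
have E x : (\sum_(w <- l) (e x w)%:Z) = (count (e x) l)%:Z.
  elim: l {ul lU} => [|w l IH]; first by rewrite big_nil.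
  by rewrite big_cons IH /= PoszD.
rewrite /diff_nbr sumrB !E.
move: (degree_in e U u) (degree_in e U v) (count _ _) (count _ _) => a b x y.
by rewrite [RHS]subr_eq addrAC [RHS]eq_sym subr_eq -!PoszD eqz_nat eq_sym addnC [(y + a)%N]addnC.
Qed.

(** Markov's inequality for the number of clipped vertices. *)
Lemma most_unclipped (R : realFieldType) (T : finType) (e : rel T) (U D : {set T})
    (r g : nat) (scale : R) :
  0 < scale -> (0 < g)%N ->
  4 * (#|T|%:R * (#|U|%:R * r%:R ^+ 2)) <= g%:R * scale ^+ 2 ->
  (#|{ffun T -> 'I_r}| <= 2 * #|[set z | @unclipped R T e U D r g scale z]|)%N.
Proof.
move=> s0 g0 h.
pose good := [set z | @unclipped R T e U D r g scale z].
have cZ : (#|{ffun T -> 'I_r}| = #|good| + #|~: good|)%N by rewrite cardsC.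
suff : (2 * #|~: good| <= #|{ffun T -> 'I_r}|)%N by rewrite -/good cZ; clear; lia.
have h1 : \sum_z #|@clipped R T e U D r scale z|%:R * scale ^+ 2 <=
    #|{ffun T -> 'I_r}|%:R * (#|T|%:R * (#|U|%:R * r%:R ^+ 2)).
  exact: sum_clipped.
rewrite -mulr_suml in h1.
have h2 : #|~: good|%:R * g%:R <= 2 * \sum_z #|@clipped R T e U D r scale z|%:R :> R.
  rewrite mulr_natl -sumr_const mulr_sumr big_mkcond; apply: ler_sum => z _.
  case: ifP => [|_]; last by rewrite mulr_ge0.
  by rewrite !inE /unclipped -ltnNge -natrM ler_nat => /ltnW.
move: h1 h2; set Z := #|{ffun _}|; set b := #|~: good|; set S := \sum_z _ => h1 h2.
rewrite -(ler_nat R) natrM -(ler_pM2r (_ : 0 < g%:R * scale ^+ 2)); last first.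
  by rewrite mulr_gt0 ?ltr0n // exprn_gt0.
have h3 : b%:R * g%:R * scale ^+ 2 <= 2 * (S * scale ^+ 2).
  by rewrite mulrA; apply: ler_wpM2r => //; apply: sqr_ge0.
have h4 : Z%:R * (4 * (#|T|%:R * (#|U|%:R * r%:R ^+ 2))) <= Z%:R * (g%:R * scale ^+ 2).
  exact: ler_wpM2l.
move: h1 h3 h4; set x := S * _; set y := #|T|%:R * _; move: (b%:R) (Z%:R) (g%:R) (scale ^+ 2).
by clear => b Z g s2 h1 h3 h4; lra.
Qed.

Section Numerics.
Variables (R : realFieldType) (x c g : R).
Hypotheses (x0 : 0 < x) (c1 : 1 <= c) (g0 : 0 < g) (hx : x ^+ 2 <= 64 * c * g).

Lemma numeric_separation :
  4 * (64 * x ^+ 2) * ((1024 * c * (128 * c)) ^+ 2)^-1 <= (g / (128 * c * x)) ^+ 2.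
Proof.
have c0 : 0 < c by apply: lt_le_trans c1.
have -> : 4 * (64 * x ^+ 2) * ((1024 * c * (128 * c)) ^+ 2)^-1 =
    (x / (64 * c) / (128 * c)) ^+ 2 by field; rewrite lt0r_neq0.
have -> : g / (128 * c * x) = g / x / (128 * c) by field; rewrite !lt0r_neq0.
have c64 : 0 < 64 * c by rewrite mulr_gt0.
have c128 : 0 < 128 * c by rewrite mulr_gt0.
have h : x / (64 * c) <= g / x.
  by rewrite ler_pdivrMr // mulrAC ler_pdivlMr // -expr2 mulrC.
apply: lerXn2r; rewrite ?nnegrE.
- by apply/ltW/divr_gt0 => //; apply: divr_gt0.
- by apply/ltW/divr_gt0 => //; apply: divr_gt0.
- by rewrite ler_pM2r // invr_gt0.
Qed.

Lemma numeric_point : 1 <= (8 * c / x) ^+ 2 * g.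
Proof.
have c0 : 0 < c by apply: lt_le_trans c1.
have -> : (8 * c / x) ^+ 2 * g = c * (64 * c * g) / x ^+ 2 by field; rewrite lt0r_neq0.
rewrite ler_pdivlMr ?exprn_gt0 // mul1r; apply: (le_trans hx).
by rewrite ler_peMl // !mulr_ge0 // ltW.
Qed.

Lemma numeric_unclipped N : N <= 64 * x ^+ 2 ->
  4 * (N * x ^+ 2) <= g * (128 * c * x) ^+ 2.
Proof.
move=> hN; have c0 : 0 < c by apply: lt_le_trans c1.
have x20 : 0 < x ^+ 2 by rewrite exprn_gt0.
apply: (@le_trans _ _ (256 * (x ^+ 2 * x ^+ 2))).
  have : N * x ^+ 2 <= 64 * x ^+ 2 * x ^+ 2 by rewrite ler_pM2r.
  by move: (x ^+ 2) => y; lra.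
apply: (@le_trans _ _ (256 * (c * (64 * c * g) * x ^+ 2))).
  rewrite ler_pM2l // ler_pM2r //; apply: (le_trans hx).
  by rewrite ler_peMl // !mulr_ge0 // ltW.
by apply: le_of_eq; ring.
Qed.
End Numerics.

Definition sym_diff (T : finType) (e : rel T) (u v : T) : {set T} :=
  [set w | e u w != e v w].

(** Halve [X] into [D] and a rest, and then the rest into [F1] and [F2]. *)
Lemma split_pairs (T : finType) (e : rel T) (g : nat) (Q : {set T * T}) (X : {set T}) :
  (0 < g)%N ->
  {in Q, forall q, 16 * g <= #|sym_diff e q.1 q.2 :&: X|}%N ->
  exists (D F1 F2 : {set T}), exists2 Q' : {set T * T},
    [/\ Q' \subset Q, D :|: F1 :|: F2 \subset X,
        [&& [disjoint D & F1], [disjoint D & F2] & [disjoint F1 & F2]]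
      & (#|Q :\: Q'| * g <= 5 * #|Q|)%N] &
    {in Q', forall q, [/\ 4 * g <= #|sym_diff e q.1 q.2 :&: D|,
       g <= #|sym_diff e q.1 q.2 :&: F1| & g <= #|sym_diff e q.1 q.2 :&: F2|]}%N.
Proof.
move=> g0 hQ; pose S q := sym_diff e q.1 q.2.
have g16 : (0 < 16 * g)%N by rewrite muln_gt0.
have g4 : (0 < 4 * g)%N by rewrite muln_gt0.
have [D DX] := @halving T _ Q S X (16 * g) g16 hQ.
set Bad1 := [set i in Q | _] => hB1.
have hQ1 : {in Q :\: Bad1, forall q, 4 * g <= #|S q :&: (X :\: D)|}%N.
  move=> q; rewrite !inE => /andP[+ qQ]; rewrite qQ /= negb_or -!leqNgt => /andP[_].
  by clear; lia.
have [F1 F1X] := @halving T _ (Q :\: Bad1) S (X :\: D) (4 * g) g4 hQ1.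
set Bad2 := [set i in Q :\: Bad1 | _] => hB2.
exists D, F1, ((X :\: D) :\: F1), ((Q :\: Bad1) :\: Bad2).
  have dD : [disjoint D & X :\: D].
    by rewrite disjoints_subset; apply/subsetP => w; rewrite !inE => ->.
  have -> : Q :\: ((Q :\: Bad1) :\: Bad2) = Bad1 :|: Bad2.
    have sB1 : Bad1 \subset Q by apply/subsetP => q; rewrite inE => /andP[].
    have sB2 : Bad2 \subset Q.
      by apply/subsetP => q; rewrite inE => /andP[]; rewrite in_setD => /andP[].
    apply/setP => q; rewrite !(in_setD, in_setU).
    have /implyP := subsetP sB1 q; have /implyP := subsetP sB2 q.
    by case: (q \in Bad1); case: (q \in Bad2); case: (q \in Q).
  split.
  - by rewrite !setDDl subsetDl.
  - rewrite !subUset DX (subset_trans F1X) ?subsetDl //.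
    by rewrite setDDl subsetDl.
  - rewrite (disjointWr F1X dD) (disjointWr (subsetDl _ _) dD) /=.
    by rewrite disjoints_subset; apply/subsetP => w; rewrite !inE => ->.
  - apply: leq_trans (leq_mul (leq_card_setU Bad1 Bad2).1 (leqnn g)) _.
    have : (#|Q :\: Bad1| <= #|Q|)%N by apply/subset_leq_card/subsetDl.
    move: hB1 hB2; rewrite -/Bad1 -/Bad2.
    move: #|Bad1| #|Bad2| #|Q :\: Bad1| #|Q| => b1 b2 q1 q.
    by clear; nia.
move=> q; rewrite in_setD => /andP[n2]; rewrite in_setD => /andP[n1 qQ].
have qQ1 : q \in Q :\: Bad1 by rewrite in_setD n1.
move: n1 n2; rewrite ![q \in [set _ in _ | _]]inE qQ qQ1 /= !negb_or -!leqNgt.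
rewrite -/(S q) => /andP[h1 _] /andP[h2 h3].
by split; move: h1 h2 h3; clear; lia.
Qed.

(** The collisions number at most [cost c] r^(-4) per pair.  The value is the product
    of 24, of 8 c from [beta] = 8 c / r^3, and of the reciprocal of the separation
    parameter [k] that belongs to scale = 128 c r^3. *)
Definition cost (c : nat) : nat := (192 * c * (1024 * c * (128 * c)) ^ 2)%N.

(** The set [W] is [U] together with a random subset of [D], [F1] and [F2],
    biased on [D] only.  As [U] is kept entirely, its contribution to the
    degrees is constant, and two degrees agree when the random difference hits
    one prescribed integer. *)
Lemma few_equal_degrees (T : finType) (e : rel T) (c g r : nat) (U D F1 F2 : {set T})
    (Q : {set T * T}) :
  (0 < c)%N -> (0 < g)%N -> (0 < r)%N ->
  (r ^ 6 <= 64 * c * g)%N -> (#|T| <= 64 * r ^ 6)%N ->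
  #|U| = (r ^ 4)%N -> D :|: F1 :|: F2 \subset ~: U ->
  [&& [disjoint D & F1], [disjoint D & F2] & [disjoint F1 & F2]] ->
  {in Q, forall q, [/\ q.1 \in U, q.2 \in U & q.1 != q.2]} ->
  {in Q, forall q, [/\ 4 * g <= #|sym_diff e q.1 q.2 :&: D|,
     g <= #|sym_diff e q.1 q.2 :&: F1| & g <= #|sym_diff e q.1 q.2 :&: F2|]}%N ->
  exists2 W : {set T}, U \subset W &
    (#|[set q in Q | degree_in e W q.1 == degree_in e W q.2]| * r ^ 4 <=
      cost c * #|Q|)%N.
Proof.
move=> c0 g0 r0 hr hT cU sX /and3P[dF1 dF2 d12] hQ hQ3.
have [R _] : exists R : realFieldType, True by exists rat.
pose x : R := r%:R ^+ 3.
have x0 : 0 < x by rewrite exprn_gt0 // ltr0n.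
have cR1 : 1 <= c%:R :> R by rewrite ler1n.
have cR0 : 0 < c%:R :> R by rewrite ltr0n.
have gR0 : 0 < g%:R :> R by rewrite ltr0n.
have x2E : x ^+ 2 = (r ^ 6)%:R by rewrite /x -exprM natrX.
have hx : x ^+ 2 <= 64 * c%:R * g%:R by rewrite x2E -!natrM ler_nat.
have hN : #|T|%:R <= 64 * x ^+ 2 by rewrite x2E -natrM ler_nat.
pose scale : R := 128 * c%:R * x.
have s0 : 0 < scale by apply: mulr_gt0 => //; apply: mulr_gt0.
pose K : R := (1024 * c%:R * (128 * c%:R)) ^+ 2.
have K0 : 0 < K by apply: exprn_gt0; apply: mulr_gt0; apply: mulr_gt0.
have K1 : 1 <= K.
  by rewrite /K exprn_ege1 // -!natrM ler1n !muln_gt0 c0.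
have b0 : 0 <= 8 * c%:R / x by apply/ltW/divr_gt0 => //; apply: mulr_gt0.
pose s1 := enum F1; pose s2 := enum F2; pose s := s1 ++ enum D ++ s2.
have us : uniq s.
  rewrite !cat_uniq !enum_uniq /= !andbT; apply/andP; split; last first.
    apply/hasPn => w; rewrite !mem_enum; apply: contraL => wD.
    by rewrite (disjointFr dF2).
  apply/hasPn => w; rewrite mem_cat !mem_enum => /orP[] h.
    by rewrite (disjointFr dF1).
  by rewrite (disjointFl d12).
have sU : {in s, forall w, w \notin U}.
  move=> w; rewrite !mem_cat !mem_enum => h; have := subsetP sX w; rewrite !inE; apply.
  by case: (w \in D) h; case: (w \in F1); case: (w \in F2).
have sizes : (size s1 + size (enum D ++ s2) <= #|T|)%N.
  by rewrite -size_cat -(card_uniqP us) max_card.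
pose target u v := (degree_in e U v)%:Z - (degree_in e U u)%:Z.
have hpair u v : (u, v) \in Q ->
    r%:R * (\sum_(z | unclipped e U D g scale z)
        point (@tprob R T e U D r scale z) (diff_nbr e u v) s (target u v)) <=
    #|{ffun T -> 'I_r}|%:R * (2 * (8 * c%:R / x) * (6 / K^-1)).
  move=> uvQ; have [uU vU uv] := hQ _ uvQ; have [hD h1 h2] := hQ3 _ uvQ.
  apply: (@pair_bound R T e U D r g scale (8 * c%:R / x) (64 * x ^+ 2) K^-1 s1 s2) => //.
  - by rewrite mulr_gt0 // exprn_gt0.
  - by rewrite invr_gt0.
  - by rewrite invf_le1.
  - exact: numeric_point.
  - exact: numeric_separation.
  - by apply: le_trans hN; rewrite ler_nat.
  - by move=> w; rewrite mem_enum => wF; rewrite (disjointFl dF1).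
  - by move=> w; rewrite mem_enum => wF; rewrite (disjointFl dF2).
  - by rewrite count_enum.
  - by rewrite count_enum.
have B0 : 0 <= 2 * (8 * c%:R / x) * (6 / K^-1).
  by apply: mulr_ge0; [apply: mulr_ge0|rewrite invrK; apply/ltW/mulr_gt0].
have [|l sl hl] := @exists_few_collisions R T e U D r g scale _ _ s1 s2 Q target r0 B0 _ hpair.
  apply: most_unclipped => //.
  have -> : #|U|%:R * r%:R ^+ 2 = x ^+ 2 :> R by rewrite cU /x natrX; ring.
  exact: numeric_unclipped.
have ul : uniq l := subseq_uniq sl us.
have lU : {in l, forall w, w \notin U} by move=> w /(mem_subseq sl); apply: sU.
exists (U :|: [set w in l]); first exact: subsetUl.
have -> : [set q in Q | degree_in e (U :|: [set w in l]) q.1 ==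
     degree_in e (U :|: [set w in l]) q.2] =
   [set q in Q | \sum_(w <- l) diff_nbr e q.1 q.2 w == target q.1 q.2].
  by apply/setP => q; rewrite !inE degree_eq_iff.
move: hl; set b := #|[set q in Q | _]| => hl.
rewrite -(ler_nat R) /cost !(natrM, natrX) -/K.
have -> : b%:R * r%:R ^+ 4 = (b%:R * r%:R) * x :> R by rewrite /x; ring.
apply: le_trans (ler_wpM2r (ltW x0) hl) _.
by apply: le_of_eq; rewrite invrK; field; rewrite lt0r_neq0.
Qed.

(** Colliding pairs of [U] are diagonal, or lost in the splitting, or collide
    by chance; there are O(16^t) of each kind. *)
Lemma many_degrees (c : nat) : (0 < c)%N -> exists c' t0 : nat,
  forall (T : finType) (e : rel T) (t : nat) (U : {set T}),
    (t0 <= t)%N -> (64 ^ t <= #|T|)%N -> (#|T| <= 64 ^ t.+1)%N ->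
    #|U| = (16 ^ t)%N -> separated e c U ->
    exists W : {set T}, (16 ^ t <= c' * num_degrees e W)%N.
Proof.
move=> c0; exists (1 + 320 * c + cost c)%N, (32 * c)%N => T e t U ht hN hN' cU /separatedP sep.
pose n := (64 ^ t)%N; pose m := (16 ^ t)%N; pose g := (n %/ (32 * c))%N.
have n4 : n = (m * 4 ^ t)%N by rewrite -expnMn.
have hc4 : (32 * c <= 4 ^ t)%N by apply: leq_trans ht _; apply/ltnW/ltn_expl.
have c32 : (0 < 32 * c)%N by rewrite muln_gt0.
have m0 : (0 < m)%N by rewrite expn_gt0.
have hcn : (32 * c <= n)%N by rewrite n4; apply: leq_trans hc4 _; apply: leq_pmull.
have g0 : (0 < g)%N by rewrite divn_gt0.
have hg1 : (g * (32 * c) <= n)%N by apply: leq_trunc_div.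
have hg2 : (n <= 64 * c * g)%N.
  have : (n < g.+1 * (32 * c))%N by rewrite -ltn_divLR.
  by move: g0; clear; nia.
pose Q := [set q : T * T | [&& q.1 \in U, q.2 \in U & q.1 != q.2]].
have cQ : (#|Q| <= m * m)%N.
  rewrite /m -cU -cardsX; apply: subset_leq_card; apply/subsetP => q.
  by rewrite !inE => /and3P[-> ->].
have hQ : {in Q, forall q, 16 * g <= #|sym_diff e q.1 q.2 :&: ~: U|}%N.
  move=> q; rewrite inE => /and3P[q1 q2 q12].
  have h1 := leq_trans hN (sep _ _ q1 q2 q12).
  have h2 := cardsID U (sym_diff e q.1 q.2).
  have h3 : (#|sym_diff e q.1 q.2 :&: U| <= m)%N.
    by rewrite /m -cU; apply/subset_leq_card/subsetIr.
  rewrite -setDE -(leq_pmul2l c0).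
  have h4 : (2 * (c * m) <= n)%N.
    rewrite n4 mulnA mulnC leq_mul2l; apply/orP; right.
    by apply: leq_trans hc4; rewrite leq_mul2r orbT.
  move: h1; rewrite -/n -/(sym_diff e q.1 q.2) -h2 mulnDr => h1.
  have h5 : (c * #|sym_diff e q.1 q.2 :&: U| <= c * m)%N by rewrite leq_mul2l h3 orbT.
  move: h1 h4 h5 hg1; clear; lia.
have [D [F1 [F2 [Q' [sQ sX disj hbad] hQ']]]] := split_pairs g0 hQ.
have r6 : ((2 ^ t) ^ 6 = n)%N by rewrite -expnM mulnC expnM.
have r4 : ((2 ^ t) ^ 4 = m)%N by rewrite -expnM mulnC expnM.
have [W UW hW] : exists2 W : {set T}, U \subset W &
    (#|[set q in Q' | degree_in e W q.1 == degree_in e W q.2]| * m <= cost c * #|Q'|)%N.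
  have := @few_equal_degrees T e c g (2 ^ t) U D F1 F2 Q' c0 g0.
  rewrite r6 r4; apply => //.
  - by rewrite expn_gt0.
  - by rewrite -expnS.
  - by move=> q /(subsetP sQ); rewrite inE => /and3P[].
exists W; apply: (@leq_trans ((1 + 320 * c + cost c) *
  size (undup [seq degree_in e W v | v in U]))); last first.
  by rewrite leq_mul2l num_degrees_ge ?orbT.
have := card_sqr_collisions (degree_in e W) U; rewrite cU -/m.
set k := size _; set col := [set q | _] => hk.
have ccol : (#|col| <= m + #|Q :\: Q'| +
    #|[set q in Q' | degree_in e W q.1 == degree_in e W q.2]|)%N.
  have cdiag : #|[set (u, u) | u in U]| = m by rewrite card_imset // => u v [].
  rewrite -cdiag; apply: leq_trans (leq_add (leq_card_setU _ _).1 (leqnn _)).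
  apply: leq_trans (leq_card_setU _ _).1; apply: subset_leq_card.
  apply/subsetP => -[u v]; rewrite !in_setU in_setD inE /= => /and3P[uU vU uv].
  have [E|nuv] := eqVneq u v.
    by rewrite E (imset_f (fun u => (u, u))).
  have uvQ : (u, v) \in Q by rewrite inE uU vU.
  rewrite uvQ andbT; case: (boolP ((u, v) \in Q')) => uvQ'; rewrite ?orbT //=.
  by rewrite inE uvQ' uv orbT.
have hbad2 : (#|Q :\: Q'| <= 320 * c * m)%N.
  rewrite -(leq_pmul2r (_ : 0 < n)%N) ?expn_gt0 //.
  apply: (@leq_trans (#|Q :\: Q'| * (64 * c * g))); first by rewrite leq_mul2l hg2 orbT.
  have -> : (#|Q :\: Q'| * (64 * c * g) = 64 * c * (#|Q :\: Q'| * g))%N by ring.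
  apply: (@leq_trans (64 * c * (5 * (m * m)))).
    by rewrite leq_mul2l; apply/orP; right; apply: leq_trans hbad _; rewrite leq_mul2l cQ orbT.
  have -> : (64 * c * (5 * (m * m)) = 320 * c * m * m)%N by ring.
  rewrite leq_mul2l n4; apply/orP; right; apply: leq_pmulr; by rewrite expn_gt0.
have hW2 : (#|[set q in Q' | degree_in e W q.1 == degree_in e W q.2]| <= cost c * m)%N.
  rewrite -(leq_pmul2r m0); apply: leq_trans hW _; rewrite -mulnA leq_mul2l.
  by apply/orP; right; apply: leq_trans cQ; apply: subset_leq_card.
rewrite -(leq_pmul2r m0).
have -> : ((1 + 320 * c + cost c) * k * m = k * ((1 + 320 * c + cost c) * m))%N by ring.
apply: leq_trans hk _; rewrite leq_mul2l; apply/orP; right.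
apply: leq_trans ccol _; rewrite mulnDl (mulnDl 1) mul1n.
by apply: leq_add => //; rewrite leq_add2l.
Qed.

(** * The theorem *)

Lemma powR_two_thirds (R : realType) (n t : nat) :
  (n <= 64 ^ t)%N -> n%:R `^ (2 / 3) <= (16 ^ t)%:R :> R.
Proof.
move=> h; have p0 : 0 <= 2 / 3 :> R by rewrite divr_ge0.
apply: (@le_trans _ _ ((64 ^ t)%:R `^ (2 / 3))).
  by apply: ge0_ler_powR; rewrite ?nnegrE ?ler_nat.
have -> : (64 ^ t)%:R = (4 ^ t)%:R `^ 3%:R :> R.
  by rewrite powR_mulrn // -natrX -expnM mulnC expnM.
rewrite -powRrM (_ : 3 * (2 / 3) = 2%:R); last by field.
by rewrite powR_mulrn // -natrX -expnM mulnC expnM.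
Qed.

Lemma max_distinct_degrees_gt0 (T : finType) (e : rel T) :
  (0 < #|T|)%N -> (0 < max_distinct_degrees e)%N.
Proof.
move=> /card_gt0P[v _].
apply: leq_trans (leq_bigmax (F := num_degrees e) [set v]).
have : degree_in e [set v] v \in undup [seq degree_in e [set v] w | w in [set v]].
  by rewrite mem_undup; apply/imageP; exists v; rewrite ?inE.
by rewrite /num_degrees; case: (undup _).
Qed.

Lemma ramsey_homogeneous_lt (R : realType) (C : R) (H : nat) (T : finType) (e : rel T) t :
  0 < C -> 126 * C <= H%:R -> (0 < t)%N -> (0 < #|T| <= 64 ^ t.+1)%N -> ramsey C e ->
  forall Q : {set T}, homogeneous e Q -> (#|Q| < H * t)%N.
Proof.
move=> C0 hH t0 /andP[N0 hN] ram Q hQ; rewrite ltnNge; apply/negP => hle.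
apply: ram; exists Q; split=> //.
apply: (@le_trans _ _ (H * t)%:R); last by rewrite ler_nat.
have l64 : ln 64%:R <= 63 :> R.
  have := @le_ln1Dx R 63; rewrite (_ : 1 + 63 = 64%:R); last by rewrite nat1r.
  by apply; lra.
have lN : ln #|T|%:R <= 126 * t%:R :> R.
  apply: (@le_trans _ _ (ln (64 ^ t.+1)%:R)).
    by rewrite ler_ln ?posrE ?ltr0n ?expn_gt0 ?ler_nat.
  rewrite natrX lnXn //; apply: (@le_trans _ _ (63%:R *+ t.+1)).
    by rewrite lerMn2r l64 orbT.
  by rewrite -mulrnA -natrM ler_nat; move: t0; clear; lia.
rewrite natrM; apply: (@le_trans _ _ (126 * C * t%:R)); last exact: ler_wpM2r.
by apply: (le_trans (ler_wpM2l (ltW C0) lN)); rewrite mulrCA mulrA.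
Qed.

Theorem theorem1 (R : realType) (C : R) (C_gt0 : 0 < C) :
  exists c : R, 0 < c /\
    forall (T : finType) (e : rel T),
      simple_graph e -> ramsey C e ->
      c * #|T|%:R `^ (2 / 3) <= (max_distinct_degrees e)%:R.
Proof.
(* 126 t bounds log N, because ln 64 <= 63 and t + 1 <= 2 t *)
pose H := Num.Def.archi_bound (126 * C).
have hH : 126 * C <= H%:R.
  by apply/ltW/archi_boundP; rewrite mulr_ge0 // ltW.
have [D [t1 [D0 packing]]] := separated_of_ramsey H.
have [c' [t2 degrees]] := many_degrees D0.
pose t0 := (maxn t1 (maxn t2 1)).
(* the power of 16 also covers the graphs that are too small for the argument *)
exists ((c'.+1 * 16 ^ t0.+1)%:R^-1); split.
  by rewrite invr_gt0 ltr0n muln_gt0 expn_gt0.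
move=> T e sg ram.
have [N0|N0] := posnP #|T|.
  by rewrite N0 powR0 ?mulr0 // mulf_neq0 ?invr_neq0 // pnatr_eq0.
rewrite ler_pdivrMl; last by rewrite ltr0n muln_gt0 expn_gt0.
rewrite -natrM.
have [small|large] := leqP #|T| (64 ^ t0.+1).
  apply: (le_trans (powR_two_thirds R small)); rewrite ler_nat.
  by rewrite mulnAC leq_pmull // muln_gt0 max_distinct_degrees_gt0.
pose t := trunc_log 64 #|T|.
have /andP[hN hN'] := trunc_log_bounds (isT : 1 < 64)%N N0.
rewrite -/t in hN hN'.
have tt : (t0 < t)%N by rewrite -ltnS -(ltn_exp2l _ _ (isT : 1 < 64)%N) (ltn_trans large).
have [tt1 tt2 tt3] : [/\ t1 <= t, t2 <= t & 0 < t]%N.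
  by split; move: tt; rewrite /t0; clear; lia.
have hom := ramsey_homogeneous_lt C_gt0 hH tt3 (introT andP (conj N0 (ltnW hN'))) ram.
have [U cU sU] := packing _ _ _ sg tt1 hN hom.
have [W hW] := degrees _ _ _ _ tt2 hN (ltnW hN') cU sU.
apply: (le_trans (powR_two_thirds R (ltnW hN'))); rewrite ler_nat expnS.
have hM : (num_degrees e W <= max_distinct_degrees e)%N by exact: leq_bigmax.
apply: (@leq_trans (16 * (c' * max_distinct_degrees e))).
  by rewrite leq_mul2l /=; apply: leq_trans hW _; rewrite leq_mul2l hM orbT.
rewrite expnS.
have : (0 < 16 ^ t0)%N by rewrite expn_gt0.
move: (16 ^ t0)%N (max_distinct_degrees e) => X M X0.
have -> : (16 * (c' * M) = c' * (16 * 1) * M)%N by ring.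
by rewrite leq_mul2r leq_mul ?orbT // leq_mul2l X0 orbT.
Qed.
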